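(* Let $A\in\mathbb{R}^{m\times n}$ with $\mathrm{rank}(A)=m<n$. For $y\in\mathbb{R}^m$ and $\tau\ge0$ consider the standard Dantzig selector problem $$(\mathrm{DS})\qquad\min_x\{\|x\|_1:\ \|A^T(Ax-y)\|_\infty\le\tau\}.$$ Let $$c_A=\max_{G\subseteq\{1,\dots,n\},\,|G|=m}\{\|A_G^{-1}(AA^T)^{-1}A\|_{\infty\to1}:\ A_G\text{ is an invertible submatrix of }A\},$$ and let $\gamma=\sigma_{\infty,2}(M^1,M^2)$ be the Robinson's constant of the pair $(M^1,M^2)$ (depending on $A,y,\tau$) defined in the context. Then the following hold. (i) Suppose that $A^T$ satisfies the weak RSP of order $k$. Then for any $x\in\mathbb{R}^n$ there is an optimal solution $x^*$ of (DS) with $$\|x-x^*\|_2\le\gamma\left\{(\|A^T(Ax-y)\|_\infty-\tau)^++2\sigma_k(x)_1+c_A\tau+c_A\|A^T(Ax-y)\|_\infty\right\}.$$ In particular, for any $x$ satisfying the constraint of (DS), there is an optimal solution $x^*$ of (DS) with $$( * )\qquad\|x-x^*\|_2\le\gamma\{2\sigma_k(x)_1+c_A\tau+c_A\|A^T(Ax-y)\|_\infty\}\le2\gamma\{\sigma_k(x)_1+c_A\tau\}.$$ Conversely, if for every $y\in\mathbb{R}^m$, every sufficiently small $\tau\ge0$, and every $x$ obeying $\|A^T(Ax-y)\|_\infty\le\tau$, there is an optimal solution $x^*$ of (DS) such that $( * )$ holds, then $A^T$ must satisfy the weak RSP of order $k$. (ii) Each of the following conditions is sufficient to ensure that for any $x$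 obeying $\|A^T(Ax-y)\|_\infty\le\tau$ there is an optimal solution $x^*$ of (DS) such that $( * )$ holds: (a) $A$ (with $\ell_2$-normalized columns) satisfies the mutual coherence property $\mu_1(k)+\mu_1(k-1)<1$; (b) RIP of order $2k$ with constant $\delta_{2k}<1/\sqrt2$; (c) stable NSP of order $k$ with constant $\rho\in(0,1)$; (d) robust NSP of order $k$ with constants $\rho'\in(0,1)$, $\rho''>0$; (e) NSP of order $k$; (f) RSP of order $k$ of $A^T$.
   Context: Notation: $(s)^+=\max\{s,0\}$; $\sigma_k(x)_1=\inf_u\{\|x-u\|_1:\|u\|_0\le k\}$, where $\|u\|_0$ is the number of nonzero entries; $A_G$ is the submatrix of $A$ consisting of columns indexed by $G$; $\|Q\|_{\infty\to1}=\max_{\|x\|_\infty\le1}\|Qx\|_1$; for $S\subseteq\{1,\dots,n\}$, $\overline S$ is its complement and $\zeta_S$ the subvector of $\zeta$ indexed by $S$. Weak RSP of order $k$ of $A^T$: for any disjoint $S_1,S_2\subseteq\{1,\dots,n\}$ with $|S_1|+|S_2|\le k$ there exists $\zeta\in\mathcal{R}(A^T)$ (the range of $A^T$) with $\zeta_i=1$ for $i\in S_1$, $\zeta_i=-1$ for $i\in S_2$, and $|\zeta_i|\le1$ for $i\notin S_1\cup S_2$. RSP of order $k$ of $A^T$: the same with $|\zeta_i|<1$ for $i\notin S_1\cup S_2$. Other matrix conditions. Mutual coherence: for $A$ with $\ell_2$-normalized columns $a_1,\dots,a_n$, $\mu_1(k)=\max_{i}\max\{\sum_{j\in S}|a_i^Ta_j|:\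 S\subseteq\{1,\dots,n\},\ |S|=k,\ i\notin S\}$ (with $1\le k\le n-1$, and $\mu_1(0)=0$). RIP of order $k$ with constant $\delta_k\in(0,1)$: $(1-\delta_k)\|x\|_2^2\le\|Ax\|_2^2\le(1+\delta_k)\|x\|_2^2$ for all $k$-sparse $x$ (at most $k$ nonzero entries). NSP of order $k$: $\|\zeta_S\|_1<\|\zeta_{\overline S}\|_1$ for all $\zeta\ne0$ with $A\zeta=0$ and all $|S|\le k$. Stable NSP of order $k$ with constant $\rho\in(0,1)$: $\|\zeta_S\|_1\le\rho\|\zeta_{\overline S}\|_1$ for all $\zeta\neq 0$ with $A\zeta=0$ and all $|S|\le k$. Robust NSP of order $k$ with constants $\rho'\in(0,1)$, $\rho''>0$: $\|\zeta_S\|_1\le\rho'\|\zeta_{\overline S}\|_1+\rho''\|A\zeta\|$ for all $\zeta\in\mathbb{R}^n$ and all $|S|\le k$, where $\|\cdot\|$ is a norm on $\mathbb{R}^m$. Robinson's constant: for $M'\in\mathbb{R}^{p_1\times r}$, $M''\in\mathbb{R}^{p_2\times r}$ let $$\mu_{\alpha_1,\alpha_2}(M',M'')=\max_{(d',d'')\in\mathcal F,\ \|(d',d'')\|_{\alpha_2}\le1}\ \min_{u\in\mathbb{R}^r}\{\|u\|_{\alpha_1}:\ M'u\le d',\ M''u=d''\},$$ with $\mathcal F=\{(d',d''):\ M'u\le d',\ M''u=d''\text{ for some }u\in\mathbb{R}^r\}$ (this is a finite number). For $N^1\in\mathbb{R}^{m_1\times\ell}$, $N^2\in\mathbb{R}^{m_2\times\ell}$,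 $$\sigma_{\alpha_1,\alpha_2}(N^1,N^2)=\max_{S\subseteq\{1,\dots,m_1\}}\mu_{\alpha_1,\alpha_2}\left(\begin{bmatrix}I_S&0\\-I&0\end{bmatrix},\begin{bmatrix}N^1\\N^2\end{bmatrix}^T\right),$$ where $I$ is the $m_1\times m_1$ identity, $I_S$ consists of the rows of $I$ indexed by $S$, and the first matrix has $m_1+m_2$ columns. The matrices $M^1,M^2$: take $M=A$, $q=n$, $\alpha=1$ in the following. Let $\mathbf e\in\mathbb{R}^q$ and $\widetilde{\mathbf e}\in\mathbb{R}^n$ be vectors of ones. The block columns have sizes $n,n,1,q,n,n,1,q,q,q,q$, $I$ and $0$ being identity and zero blocks of suitable sizes: $$M^1=\begin{bmatrix} I&-I&0&0&0&0&0&0&0&0&0\\ -I&-I&0&0&0&0&0&0&0&0&0\\ 0&0&\alpha&(1-\alpha)\mathbf e^T&0&0&0&0&0&0&0\\ M^TA&0&-\mathbf e&0&0&0&0&0&0&0&0\\ -M^TA&0&-\mathbf e&0&0&0&0&0&0&0&0\\ M^TA&0&0&-I&0&0&0&0&0&0&0\\ -M^TA&0&0&-I&0&0&0&0&0&0&0\\ 0&0&0&0&I&I&0&0&0&0&0\\ 0&0&0&0&0&0&-\alpha&\mathbf e^T&\mathbf e^T&0&0\\ 0&0&0&0&0&0&-(1-\alpha)\mathbf e&0&0&I&I\\ 0&0&0&0&-I&0&0&0&0&0&0\\ 0&0&0&0&0&-I&0&0&0&0&0\\ 0&0&0&0&0&0&-1&0&0&0&0\\ 0&0&0&0&0&0&0&-I&0&0&0\\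 0&0&0&0&0&0&0&0&-I&0&0\\ 0&0&0&0&0&0&0&0&0&-I&0\\ 0&0&0&0&0&0&0&0&0&0&-I \end{bmatrix},$$ $$M^2=\begin{bmatrix} 0&0&0&0&-I&I&0&A^TM&-A^TM&-A^TM&A^TM\\ 0&\widetilde{\mathbf e}^T&0&0&0&0&\tau&-y^TM&y^TM&y^TM&-y^TM \end{bmatrix}.$$ *)

(* Defs.v *)
From HB Require Import structures.
From mathcomp Require Import all_boot all_order all_algebra.
From mathcomp Require Import all_classical all_reals all_analysis.

Set Implicit Arguments.
Unset Strict Implicit.
Unset Printing Implicit Defensive.

Import Order.TTheory GRing.Theory Num.Theory.
Import numFieldNormedType.Exports.

Local Open Scope ring_scope.

Section Norms.
Variable R : realType.

Definition l1norm n (x : 'cV[R]_n) : R := \sum_i `|x i 0|.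

Definition l2norm n (x : 'cV[R]_n) : R := Num.sqrt (\sum_i x i 0 ^+ 2).

Definition linfnorm n (x : 'cV[R]_n) : R := mx_norm x.

Definition l0norm n (x : 'cV[R]_n) : nat := #|[set i | x i 0 != 0]|.

Definition l1norm_on n (S : {set 'I_n}) (x : 'cV[R]_n) : R :=
  \sum_(i in S) `|x i 0|.

Definition is_norm m (N : 'cV[R]_m -> R) : Prop :=
  [/\ forall x y, N (x + y) <= N x + N y,
      forall (a : R) x, N (a *: x) = `|a| * N x
    & forall x, N x = 0 -> x = 0].

(* Throughout, the maxima and minima of real quantities over infinite sets are
   the real sup and inf, whose value is 0 on a set that is empty or unbounded
   on the relevant side; finiteness is therefore not assumed anywhere. *)
Definition opnorm_inf_1 p q (Q : 'M[R]_(p, q)) : R :=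
  sup [set l1norm (Q *m x) | x in [set x | linfnorm x <= 1]]%classic.

Definition best_approx_l1 n (k : nat) (x : 'cV[R]_n) : R :=
  inf [set l1norm (x - u) | u in [set u | (l0norm u <= k)%N]]%classic.

End Norms.

Section MatrixConditions.
Variables (R : realType) (m n : nat) (A : 'M[R]_(m, n)) (k : nat).

Definition weak_RSP : Prop :=
  forall S1 S2 : {set 'I_n}, [disjoint S1 & S2] -> (#|S1| + #|S2| <= k)%N ->
  exists z : 'cV[R]_n,
    [/\ exists u : 'cV[R]_m, z = A^T *m u,
        forall i, i \in S1 -> z i 0 = 1,
        forall i, i \in S2 -> z i 0 = -1
      & forall i, i \notin S1 :|: S2 -> `|z i 0| <= 1].

Definition RSP : Prop :=
  forall S1 S2 : {set 'I_n}, [disjoint S1 & S2] -> (#|S1| + #|S2| <= k)%N ->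
  exists z : 'cV[R]_n,
    [/\ exists u : 'cV[R]_m, z = A^T *m u,
        forall i, i \in S1 -> z i 0 = 1,
        forall i, i \in S2 -> z i 0 = -1
      & forall i, i \notin S1 :|: S2 -> `|z i 0| < 1].

Definition normalized_columns : Prop := forall j, l2norm (col j A) = 1.

(* All the sums are nonnegative, so the default 0 of the two maxima does not
   affect them; it also gives the convention mu_1(0) = 0. *)
Definition mutual_coherence : R :=
  \big[Num.max/0]_(i < n)
    \big[Num.max/0]_(S : {set 'I_n} | (#|S| == k) && (i \notin S))
      \sum_(j in S) `|((col i A)^T *m col j A) 0 0|.

Definition RIP (delta : R) : Prop :=
  0 < delta < 1 /\
  forall x : 'cV[R]_n, (l0norm x <= k)%N ->
    (1 - delta) * l2norm x ^+ 2 <= l2norm (A *m x) ^+ 2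
      <= (1 + delta) * l2norm x ^+ 2.

Definition NSP : Prop :=
  forall z : 'cV[R]_n, z != 0 -> A *m z = 0 ->
  forall S : {set 'I_n}, (#|S| <= k)%N ->
    l1norm_on S z < l1norm_on (~: S) z.

Definition stable_NSP (rho : R) : Prop :=
  0 < rho < 1 /\
  forall z : 'cV[R]_n, z != 0 -> A *m z = 0 ->
  forall S : {set 'I_n}, (#|S| <= k)%N ->
    l1norm_on S z <= rho * l1norm_on (~: S) z.

Definition robust_NSP (N : 'cV[R]_m -> R) (rho1 rho2 : R) : Prop :=
  [/\ is_norm N, 0 < rho1 < 1, 0 < rho2
    & forall (z : 'cV[R]_n) (S : {set 'I_n}), (#|S| <= k)%N ->
        l1norm_on S z <= rho1 * l1norm_on (~: S) z + rho2 * N (A *m z)].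

End MatrixConditions.

Section RobinsonConstant.
Variable R : realType.
(* The norms alpha_1 and alpha_2, given as families defined in all dimensions. *)
Variables (N1 N2 : forall r : nat, 'cV[R]_r -> R).

Definition vec_le p (u v : 'cV[R]_p) : Prop := forall i, u i 0 <= v i 0.

(* The feasible set of the inner minimum; (d', d'') belongs to the set called F
   in the definition of Robinson's constant when it is nonempty. *)
Definition robinson_solutions p1 p2 r (M1 : 'M[R]_(p1, r)) (M2 : 'M[R]_(p2, r))
    (d : 'cV[R]_p1 * 'cV[R]_p2) : classical_sets.set 'cV[R]_r :=
  [set u | vec_le (M1 *m u) d.1 /\ M2 *m u = d.2]%classic.

Definition robinson_mu p1 p2 r (M1 : 'M[R]_(p1, r)) (M2 : 'M[R]_(p2, r)) : R :=
  sup [set inf [set N1 u | u in robinson_solutions M1 M2 d]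
      | d in [set d : 'cV[R]_p1 * 'cV[R]_p2 |
               robinson_solutions M1 M2 d !=set0
               /\ N2 (col_mx d.1 d.2) <= 1]]%classic.

Definition identity_rows p (S : {set 'I_p}) : 'M[R]_(#|S|, p) :=
  rowsub enum_val 1%:M.

(* Each robinson_mu is nonnegative when N1 is a norm, so the default 0 of the
   maximum does not affect it. *)
Definition robinson_sigma m1 m2 l (M1 : 'M[R]_(m1, l)) (M2 : 'M[R]_(m2, l)) : R :=
  \big[Num.max/0]_(S : {set 'I_m1})
    robinson_mu
      (block_mx (identity_rows S) (0 : 'M[R]_(_, m2)) (- 1%:M) 0)
      (col_mx M1 M2)^T.

End RobinsonConstant.

Section DantzigSelector.
Variables (R : realType) (m n : nat) (A : 'M[R]_(m, n)).

Section Blocks.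
Variables (q : nat) (M : 'M[R]_(m, q)) (alpha : R).

Local Notation "a ||| b" := (row_mx a b) (at level 60, right associativity).
Local Notation "a /// b" := (col_mx a b) (at level 65, right associativity).
Local Notation I := (1%:M).
Local Notation e := (const_mx 1 : 'cV[R]_q).
Local Notation G := (M^T *m A).
Local Notation a := (alpha%:M : 'M[R]_1).
Local Notation b := (1 - alpha).

Local Notation ncols :=
  (n + (n + (1 + (q + (n + (n + (1 + (q + (q + (q + q))))))))))%N.
Local Notation nrows :=
  (n + (n + (1 + (q + (q + (q + (q + (n + (1 + (q + (n + (n
    + (1 + (q + (q + (q + q))))))))))))))))%N.

Definition DS_M1 : 'M[R]_(nrows, ncols) :=
     (I   ||| -I  ||| 0   ||| 0          ||| 0  ||| 0  ||| 0         ||| 0    ||| 0    ||| 0  ||| 0 )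
 /// (-I  ||| -I  ||| 0   ||| 0          ||| 0  ||| 0  ||| 0         ||| 0    ||| 0    ||| 0  ||| 0 )
 /// (0   ||| 0   ||| a   ||| b *: e^T   ||| 0  ||| 0  ||| 0         ||| 0    ||| 0    ||| 0  ||| 0 )
 /// (G   ||| 0   ||| -e  ||| 0          ||| 0  ||| 0  ||| 0         ||| 0    ||| 0    ||| 0  ||| 0 )
 /// (-G  ||| 0   ||| -e  ||| 0          ||| 0  ||| 0  ||| 0         ||| 0    ||| 0    ||| 0  ||| 0 )
 /// (G   ||| 0   ||| 0   ||| -I         ||| 0  ||| 0  ||| 0         ||| 0    ||| 0    ||| 0  ||| 0 )
 /// (-G  ||| 0   ||| 0   ||| -I         ||| 0  ||| 0  ||| 0         ||| 0    ||| 0    ||| 0  ||| 0 )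
 /// (0   ||| 0   ||| 0   ||| 0          ||| I  ||| I  ||| 0         ||| 0    ||| 0    ||| 0  ||| 0 )
 /// (0   ||| 0   ||| 0   ||| 0          ||| 0  ||| 0  ||| -a        ||| e^T  ||| e^T  ||| 0  ||| 0 )
 /// (0   ||| 0   ||| 0   ||| 0          ||| 0  ||| 0  ||| -(b *: e) ||| 0    ||| 0    ||| I  ||| I )
 /// (0   ||| 0   ||| 0   ||| 0          ||| -I ||| 0  ||| 0         ||| 0    ||| 0    ||| 0  ||| 0 )
 /// (0   ||| 0   ||| 0   ||| 0          ||| 0  ||| -I ||| 0         ||| 0    ||| 0    ||| 0  ||| 0 )
 /// (0   ||| 0   ||| 0   ||| 0          ||| 0  ||| 0  ||| -I        ||| 0    ||| 0    ||| 0  ||| 0 )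
 /// (0   ||| 0   ||| 0   ||| 0          ||| 0  ||| 0  ||| 0         ||| -I   ||| 0    ||| 0  ||| 0 )
 /// (0   ||| 0   ||| 0   ||| 0          ||| 0  ||| 0  ||| 0         ||| 0    ||| -I   ||| 0  ||| 0 )
 /// (0   ||| 0   ||| 0   ||| 0          ||| 0  ||| 0  ||| 0         ||| 0    ||| 0    ||| -I ||| 0 )
 /// (0   ||| 0   ||| 0   ||| 0          ||| 0  ||| 0  ||| 0         ||| 0    ||| 0    ||| 0  ||| -I).

Definition DS_M2 (y : 'cV[R]_m) (tau : R) : 'M[R]_(n + 1, ncols) :=
  let e' := const_mx 1 : 'cV[R]_n in
  let B := A^T *m M in
  let c := y^T *m M in
     (0 ||| 0     ||| 0 ||| 0 ||| -I ||| I ||| 0       ||| B  ||| -B ||| -B ||| B )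
 /// (0 ||| e'^T  ||| 0 ||| 0 ||| 0  ||| 0 ||| tau%:M  ||| -c ||| c  ||| c  ||| -c).

End Blocks.

Definition DS_feasible (y : 'cV[R]_m) (tau : R) (x : 'cV[R]_n) : Prop :=
  linfnorm (A^T *m (A *m x - y)) <= tau.

Definition DS_optimal (y : 'cV[R]_m) (tau : R) (x : 'cV[R]_n) : Prop :=
  DS_feasible y tau x /\
  forall z, DS_feasible y tau z -> l1norm x <= l1norm z.

(* The columns of G are listed in increasing order. *)
Definition column_submatrix (G : {set 'I_n}) (hG : #|G| = m) : 'M[R]_m :=
  colsub (fun i : 'I_m => enum_val (cast_ord (esym hG) i)) A.

Definition DS_c : R :=
  sup [set v | exists (G : {set 'I_n}) (hG : #|G| = m),
         column_submatrix hG \in unitmx /\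
         v = opnorm_inf_1 (invmx (column_submatrix hG)
                             *m invmx (A *m A^T) *m A)]%classic.

Definition DS_gamma (y : 'cV[R]_m) (tau : R) : R :=
  robinson_sigma (@linfnorm R) (@l2norm R) (DS_M1 A 1) (DS_M2 A y tau).

(* The two-sided bound on the distance from x to xs, as a chain of inequalities. *)
Definition DS_stable_at (k : nat) (y : 'cV[R]_m) (tau : R) (x xs : 'cV[R]_n) : Prop :=
  let gamma := DS_gamma y tau in
  let r := linfnorm (A^T *m (A *m x - y)) in
  let s := best_approx_l1 k x in
  l2norm (x - xs) <= gamma * (2 * s + DS_c * tau + DS_c * r)
    <= 2 * gamma * (s + DS_c * tau).

Definition DS_stable (k : nat) (y : 'cV[R]_m) (tau : R) : Prop :=
  forall x, DS_feasible y tau x ->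
  exists2 xs, DS_optimal y tau xs & DS_stable_at k y tau x xs.

End DantzigSelector.

(* Main.v *)
(* The optimal solutions of (DS) are the x-parts of the solutions of the linear
   system M^1 z <= b, M^2 z = 0, which expresses primal feasibility, dual feasibility
   and a zero duality gap, and Robinson's constant bounds the distance from any z to
   that polyhedron by the l1 norm of its residual.  Given x, the weak RSP yields
   zeta in the range of A^T carrying the signs of x on k dominant entries, and a basic
   solution h of A^T A h = zeta has l1 norm at most c_A; completing (x, h) to a vector z
   leaves only the residuals (|A^T (A x - y)| - tau)^+ and the duality gap, which is
   at most 2 sigma_k(x)_1 + c_A tau + c_A |A^T (A x - y)|.  For tau = 0 the stability
   bound says that k-sparse vectors are l1-minimal, which is the weak RSP by linear
   programming duality; each condition in (ii) makes k-sparse vectors l1-minimal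
   as well. *)

Require Import Defs.
From mathcomp Require Import all_boot all_order all_algebra.
From mathcomp Require Import all_classical all_reals all_analysis.
From mathcomp Require Import ring lra.

Import Order.TTheory GRing.Theory Num.Theory.
Import numFieldNormedType.Exports.
Local Open Scope ring_scope.

Set Implicit Arguments.
Unset Strict Implicit.
Unset Printing Implicit Defensive.

(** * Inner product and norms *)

(** Robinson's constant and c_A are real suprema with default value 0 on unbounded sets, so bounding
    a quantity by them requires these sets to be bounded. For Robinson's constant this is Hoffman's
    bound: a solvable system M u <= d has a solution whose entries are at most a constant times the
    l1 norm of d. The same bound yields the minimisers: a least-squares objective sees a point of a
    polyhedron only through its image, and images no worse than a given one are realised inside a
    fixed box, where compactness applies. Duality grows out of this single problem: Farkas' lemma is
    projection onto a cone, the Karush-Kuhn-Tucker conditions are Farkas' lemma for the active rows,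
    and strong duality takes the objective itself as the residual to be squared. Robinson's bound
    also presupposes a point of the polyhedron, which strong duality for (DS) supplies. *)

Definition dot (R : realType) n (u v : 'cV[R]_n) : R := (u^T *m v) 0 0.

Section Dot.
Variable R : realType.

Lemma dotE n (u v : 'cV[R]_n) : dot u v = \sum_i u i 0 * v i 0.
Proof. by rewrite /dot mxE; apply: eq_bigr => i _; rewrite mxE. Qed.

Lemma dotC n (u v : 'cV[R]_n) : dot u v = dot v u.
Proof. by rewrite !dotE; apply: eq_bigr => i _; rewrite mulrC. Qed.

Lemma dotDl n (u v w : 'cV[R]_n) : dot (u + v) w = dot u w + dot v w.
Proof. by rewrite /dot linearD mulmxDl mxE. Qed.

Lemma dotZl n a (u v : 'cV[R]_n) : dot (a *: u) v = a * dot u v.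
Proof. by rewrite /dot linearZ -scalemxAl mxE. Qed.

Lemma dotNl n (u v : 'cV[R]_n) : dot (- u) v = - dot u v.
Proof. by rewrite /dot linearN mulNmx mxE. Qed.

Lemma dotDr n (u v w : 'cV[R]_n) : dot u (v + w) = dot u v + dot u w.
Proof. by rewrite dotC dotDl !(dotC u). Qed.

Lemma dotZr n a (u v : 'cV[R]_n) : dot u (a *: v) = a * dot u v.
Proof. by rewrite dotC dotZl dotC. Qed.

Lemma dotNr n (u v : 'cV[R]_n) : dot u (- v) = - dot u v.
Proof. by rewrite dotC dotNl dotC. Qed.

Lemma dot0l n (v : 'cV[R]_n) : dot 0 v = 0.
Proof. by rewrite /dot trmx0 mul0mx mxE. Qed.

Lemma dot0r n (v : 'cV[R]_n) : dot v 0 = 0.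
Proof. by rewrite dotC dot0l. Qed.

Lemma dot_mull m n (P : 'M[R]_(m, n)) u v : dot (P *m u) v = dot u (P^T *m v).
Proof. by rewrite /dot trmx_mul mulmxA. Qed.

Lemma dot_mulr m n (P : 'M[R]_(m, n)) u v : dot u (P *m v) = dot (P^T *m u) v.
Proof. by rewrite dot_mull trmxK. Qed.

Lemma dot_col_mx m n (u u' : 'cV[R]_m) (v v' : 'cV[R]_n) :
  dot (col_mx u v) (col_mx u' v') = dot u u' + dot v v'.
Proof. by rewrite /dot tr_col_mx mul_row_col mxE. Qed.

Lemma dot_ge0 n (u : 'cV[R]_n) : 0 <= dot u u.
Proof. by rewrite dotE; apply: sumr_ge0 => i _; apply: sqr_ge0. Qed.

Lemma dot_eq0 n (u : 'cV[R]_n) : dot u u = 0 -> u = 0.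
Proof.
rewrite dotE => /psumr_eq0P H; apply/colP => i; rewrite mxE.
apply/eqP; rewrite -[_ == _]orbb -mulf_eq0; apply/eqP/H => // j _.
exact: sqr_ge0.
Qed.

Lemma l2norm_ge0 n (u : 'cV[R]_n) : 0 <= l2norm u.
Proof. exact: sqrtr_ge0. Qed.

Lemma sqr_l2norm n (u : 'cV[R]_n) : l2norm u ^+ 2 = dot u u.
Proof.
rewrite /l2norm sqr_sqrtr; last by rewrite sumr_ge0 // => i _; rewrite sqr_ge0.
by rewrite dotE; apply: eq_bigr => i _; rewrite expr2.
Qed.

Lemma abs_le_l2norm n (u : 'cV[R]_n) i : `|u i 0| <= l2norm u.
Proof.
rewrite -sqrtr_sqr ler_sqrt; last by rewrite sumr_ge0 // => j _; rewrite sqr_ge0.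
by rewrite (bigD1 i) //= lerDl sumr_ge0 // => j _; rewrite sqr_ge0.
Qed.

Lemma l2norm_col_mx m n (u : 'cV[R]_m) (v : 'cV[R]_n) :
  l2norm u <= l2norm (col_mx u v).
Proof.
rewrite -(@ler_pXn2r _ 2) ?nnegrE ?l2norm_ge0 //.
by rewrite !sqr_l2norm dot_col_mx lerDl dot_ge0.
Qed.

Lemma l1norm_ge0 n (u : 'cV[R]_n) : 0 <= l1norm u.
Proof. by rewrite sumr_ge0. Qed.

Lemma abs_le_l1norm n (u : 'cV[R]_n) i : `|u i 0| <= l1norm u.
Proof. by rewrite /l1norm (bigD1 i) //= lerDl sumr_ge0. Qed.

Lemma linfnorm_leP n (u : 'cV[R]_n) (B : R) : 0 <= B ->
  reflect (forall i, `|u i 0| <= B) (linfnorm u <= B).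
Proof.
move=> B0; rewrite /linfnorm mx_normrE; apply: (iffP (bigmax_leP _ _ _ _)).
  by move=> [_ H] i; have /= := H (i, 0) isT.
by move=> H; split=> // -[i j] _ /=; rewrite ord1.
Qed.

Lemma abs_le_linfnorm n (u : 'cV[R]_n) i : `|u i 0| <= linfnorm u.
Proof.
by rewrite /linfnorm mx_normrE; apply/bigmax_geP; right; exists (i, 0).
Qed.

Lemma linfnorm_ge0 n (u : 'cV[R]_n) : 0 <= linfnorm u.
Proof. by rewrite /linfnorm mx_normrE bigmax_ge_id. Qed.

Lemma dot_le_linf_l1 n (u v : 'cV[R]_n) : `|dot u v| <= linfnorm u * l1norm v.
Proof.
rewrite dotE (le_trans (ler_norm_sum _ _ _)) // mulr_sumr ler_sum // => i _.
by rewrite normrM ler_wpM2r // abs_le_linfnorm.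
Qed.

End Dot.

(** * Polyhedra: Hoffman's bound and Farkas' lemma *)

(** Rows outside [I] are zeroed rather than deleted, so that the dimensions do not depend on [I]. *)
Definition row_mask (R : realType) p (I : {set 'I_p}) : 'M[R]_p :=
  diag_mx (\row_i (i \in I)%:R).

Lemma row_maskE (R : realType) p q I (B : 'M[R]_(p, q)) i j :
  (row_mask R I *m B) i j = if i \in I then B i j else 0.
Proof.
by rewrite mul_diag_mx !mxE; case: ifP; rewrite ?mul1r ?mul0r.
Qed.

Section Hoffman.
Variables (R : realType) (p r : nat) (M : 'M[R]_(p, r)).

Let active (d : 'cV[R]_p) (u : 'cV[R]_r) : {set 'I_p} := [set i | (M *m u) i 0 == d i 0].

(* Moving along a direction that leaves the active constraints unchanged, until
   another constraint becomes active. *)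
Let more_active d u (w : 'cV[R]_r) i0 : vec_le (M *m u) d ->
    (forall i, i \in active d u -> (M *m w) i 0 = 0) -> 0 < (M *m w) i0 0 ->
  exists2 u', vec_le (M *m u') d & (#|active d u| < #|active d u'|)%N.
Proof.
move=> fu w0 wi0.
pose P := [pred i | 0 < (M *m w) i 0].
pose f i := (d i 0 - (M *m u) i 0) / (M *m w) i 0.
have [i1 Pi1 min1] := @arg_minP _ _ _ i0 P f wi0.
have Mu' i : (M *m (u + f i1 *: w)) i 0 = (M *m u) i 0 + f i1 * (M *m w) i 0.
  by rewrite mulmxDr -scalemxAr !mxE.
have f0 : 0 <= f i1 by rewrite divr_ge0 ?subr_ge0 ?(ltW Pi1).
have act1 : (M *m (u + f i1 *: w)) i1 0 = d i1 0.
  by rewrite Mu' /f divfK ?gt_eqF // addrC subrK.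
exists (u + f i1 *: w).
  move=> i; rewrite Mu'; have [wi|wi] := ltP 0 ((M *m w) i 0).
    by rewrite addrC -lerBrDr -ler_pdivlMr // min1.
  by rewrite -[leRHS]addr0 lerD // mulr_ge0_le0.
apply/proper_card/properP; split.
  by apply/fintype.subsetP => i iu; rewrite inE Mu' (w0 i iu) mulr0 addr0; rewrite inE in iu.
exists i1; first by rewrite inE act1.
by apply/negP => /w0 H; move: Pi1; rewrite /= H ltxx.
Qed.

(** As long as the active rows do not span the row space of [M], a column [w] of their cokernel is
    orthogonal to them but not to all of [M]; moving along [w] or [-w] activates one more
    constraint, and there are only [p] of them. *)
Let spanning_active d u : vec_le (M *m u) d ->
  exists2 u', vec_le (M *m u') d & (M <= row_mask R (active d u') *m M)%MS.
Proof.
have [N] := ubnP (p - #|active d u|)%N; elim: N u => // N IH u ltN fu.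
have [|] := boolP (M <= row_mask R (active d u) *m M)%MS; first by exists u.
rewrite submxE => /matrix0Pn[i [j Mij]].
pose w := col j (cokermx (row_mask R (active d u) *m M)).
have Mw l : (M *m w) l 0 = (M *m cokermx (row_mask R (active d u) *m M)) l j.
  by rewrite !mxE; apply: eq_bigr => s _; rewrite mxE.
have w0 l : l \in active d u -> (M *m w) l 0 = 0.
  move=> lu; have := mulmx_coker (row_mask R (active d u) *m M).
  by rewrite -mulmxA => /matrixP/(_ l j); rewrite row_maskE lu -Mw => ->; rewrite mxE.
have [u' fu' ltu'] : exists2 u', vec_le (M *m u') d & (#|active d u| < #|active d u'|)%N.
  have [wi|wi|wi] := ltrgtP 0 ((M *m w) i 0).
  - exact: more_active w0 wi.
  - apply: (@more_active d u (- w) i) => // [l lu|]; rewrite mulmxN mxE.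
      by rewrite w0 ?oppr0.
    by rewrite oppr_gt0.
  - by move: Mij; rewrite -Mw -wi eqxx.
apply: IH fu'; rewrite ltnS in ltN; apply: leq_trans ltN.
apply: ltn_sub2l => //; apply: leq_trans ltu' _.
by rewrite -[X in (_ <= X)%N]card_ord max_card.
Qed.

(** Once the active rows span, they determine [M u], and a pseudo-inverse recovers a point with this
    image linearly from [d]. The linear map depends only on the active set, so summing the entries
    over the finitely many sets gives a uniform constant. *)
Lemma hoffman_bound : exists2 C : R, 0 <= C &
  forall d u, vec_le (M *m u) d ->
  exists2 u', vec_le (M *m u') d & forall i, `|u' i 0| <= C * l1norm d.
Proof.
pose Q I := pinvmx (row_mask R I *m M) *m row_mask R I.
pose c := \sum_I \sum_ij `|Q I ij.1 ij.2|.
exists c; first by rewrite sumr_ge0 // => I _; rewrite sumr_ge0.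
move=> d u /spanning_active[{}u fu].
set I := active d u => MI.
have mask_d : row_mask R I *m d = row_mask R I *m M *m u.
  apply/colP => i; rewrite -mulmxA !row_maskE; case: ifP => //.
  by rewrite inE => /eqP.
exists (Q I *m d) => [|i].
  pose K := row_mask R I *m M; pose X := M *m pinvmx K.
  have XK : M = X *m K by rewrite mulmxKpV.
  suff -> : M *m (Q I *m d) = M *m u by [].
  by rewrite -(mulmxA (pinvmx _)) mask_d -/K [LHS]mulmxA -/X mulmxA -XK.
rewrite mxE (le_trans (ler_norm_sum _ _ _)) // mulr_sumr ler_sum // => j _.
rewrite normrM ler_wpM2r // /c (bigD1 I) //= (bigD1 (i, j)) //= -addrA lerDl.
by rewrite addr_ge0 ?sumr_ge0 // => J _; rewrite sumr_ge0.
Qed.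

End Hoffman.

Section Polyhedra.
Variable R : realType.

(** Points are row vectors here because [rV_compact] and [EVT_min_rV] are about row vectors. *)
Lemma continuous_row_form p r (N : 'M[R]_(p, r)) i :
  continuous (fun u : 'rV[R]_r => (N *m u^T) i 0).
Proof.
have -> : (fun u : 'rV[R]_r => (N *m u^T) i 0) = fun u => \sum_j N i j * u 0 j.
  by apply/funext => u; rewrite mxE; apply: eq_bigr => j _; rewrite mxE.
apply: continuous_big => [|j _ u]; first exact: add_continuous.
by apply: continuousM; [exact: cst_continuous|exact: coord_continuous].
Qed.

Lemma continuous_residual p r (B : 'M[R]_(p, r)) c :
  continuous (fun u : 'rV[R]_r => dot (B *m u^T - c) (B *m u^T - c)).
Proof.
have -> : (fun u : 'rV[R]_r => dot (B *m u^T - c) (B *m u^T - c)) =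
    fun u => \sum_i ((B *m u^T) i 0 - c i 0) * ((B *m u^T) i 0 - c i 0).
  apply/funext => u; rewrite dotE.
  by apply: eq_bigr => i _; rewrite [(_ - c) i 0]mxE [(- c) i 0]mxE.
apply: continuous_big => [|i _ u]; first exact: add_continuous.
have cont : {for u, continuous (fun u : 'rV[R]_r => (B *m u^T) i 0 - c i 0)}.
  by apply: continuousB; [exact: continuous_row_form|exact: cst_continuous].
exact: (continuousM cont cont).
Qed.

Lemma l1norm_col_mx m n (u : 'cV[R]_m) (v : 'cV[R]_n) :
  l1norm (col_mx u v) = l1norm u + l1norm v.
Proof.
rewrite /l1norm big_split_ord; congr (_ + _); apply: eq_bigr => i _.
  by rewrite col_mxEu.
by rewrite col_mxEd.
Qed.

Lemma l1normN n (u : 'cV[R]_n) : l1norm (- u) = l1norm u.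
Proof. by apply: eq_bigr => i _; rewrite mxE normrN. Qed.

Lemma vec_le_col_mx m n (u u' : 'cV[R]_m) (v v' : 'cV[R]_n) :
  vec_le (col_mx u v) (col_mx u' v') <-> vec_le u u' /\ vec_le v v'.
Proof.
split=> [H|[Hu Hv] i].
  by split=> i; [have := H (lshift n i) | have := H (rshift m i)];
    rewrite ?col_mxEu ?col_mxEd.
by case: (split_ordP i) => j ->; rewrite ?col_mxEu ?col_mxEd.
Qed.

Lemma vec_le_anti n (u v : 'cV[R]_n) : vec_le u v -> vec_le (- u) (- v) -> u = v.
Proof.
move=> H1 H2; apply/colP => i; apply/eqP; rewrite eq_le H1 /=.
by have := H2 i; rewrite !mxE lerN2.
Qed.

Lemma vec_le_refl n (u : 'cV[R]_n) : vec_le u u.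
Proof. by move=> i. Qed.

Lemma compact_polyhedron_box p r (N : 'M[R]_(p, r)) b (D : R) :
  compact [set u : 'rV[R]_r | vec_le (N *m u^T) b /\ forall j, `|u 0 j| <= D]%classic.
Proof.
have cbox : compact [set v : 'rV[R]_r | forall i, (v ord0 i \in `[- D, D])%R]%classic.
  by apply: (@rV_compact _ _ (fun=> `[- D, D]%classic)) => _; exact: segment_compact.
apply: (subclosed_compact _ cbox) => [|u [_ H] i]; last first.
  by rewrite in_itv /= -ler_norml; exact: H.
have -> : [set u : 'rV[R]_r | vec_le (N *m u^T) b /\ forall j, `|u 0 j| <= D]%classic =
  (\bigcap_(i in setT) [set u : 'rV[R]_r | ((N *m u^T) i 0 <= b i 0)%R] `&`
   \bigcap_(j in setT) [set u : 'rV[R]_r | (`|u 0 j| <= D)%R])%classic.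
  apply/seteqP; split=> u /= [H1 H2].
    by split=> i _; [exact: H1|exact: H2].
  by split=> i; [exact: H1|exact: H2].
apply: closedI; apply: closed_bigI => i _.
  apply: (@preimage_closed _ _ (fun u : 'rV[R]_r => (N *m u^T) i 0)
    [set x | x <= b i 0]%classic).
    by move=> u _; exact: continuous_row_form.
  exact: closed_le.
apply: (@preimage_closed _ _ (fun u : 'rV[R]_r => `|u 0 i|) [set x | x <= D]%classic).
  by move=> u _; apply: continuous_comp; [exact: coord_continuous|exact: norm_continuous].
exact: closed_le.
Qed.

(* Hoffman's bound confines the search for a minimiser to a compact set. *)
Lemma least_squares_polyhedron p r s (N : 'M[R]_(p, r)) b (B : 'M[R]_(s, r)) c z0 :
  vec_le (N *m z0) b ->
  exists2 z, vec_le (N *m z) b & forall z', vec_le (N *m z') b ->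
    dot (B *m z - c) (B *m z - c) <= dot (B *m z' - c) (B *m z' - c).
Proof.
move=> fz0.
pose obj z := dot (B *m z - c) (B *m z - c); rewrite -!/(obj _).
have [C C0 HC] := hoffman_bound (col_mx N (col_mx B (- B))).
pose L := l2norm (B *m z0 - c).
pose D := l1norm b + (\sum_i (`|c i 0| + L) + \sum_i (`|c i 0| + L)).
(* Hoffman's bound for the system [N z' <= b], [B z' = B z]: when [z] is no worse than [z0], each
   entry of [B z] is within [L] of that of [c], so the right-hand side has l1 norm at most [D]. The
   sum occurs twice in [D] because an equation is two inequalities. *)
have confine z : vec_le (N *m z) b -> obj z <= obj z0 ->
    exists z', [/\ vec_le (N *m z') b, B *m z' = B *m z & forall i, `|z' i 0| <= C * D].
  move=> fz lez.
  have [|z'] := HC (col_mx b (col_mx (B *m z) (- B *m z))) z.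
    rewrite !mul_col_mx; apply/vec_le_col_mx; split=> //.
  rewrite !mul_col_mx => /vec_le_col_mx[fz' /vec_le_col_mx[H1 H2]] bz'.
  exists z'; split=> //; first by apply: vec_le_anti; rewrite // -!mulNmx.
  move=> i; apply: le_trans (bz' i) _; rewrite ler_wpM2l // !l1norm_col_mx lerD2l.
  rewrite mulNmx l1normN.
  suff H : l1norm (B *m z) <= \sum_i (`|c i 0| + L) by apply: lerD.
  apply: ler_sum => j _.
  have -> : (B *m z) j 0 = c j 0 + (B *m z - c) j 0.
    by rewrite [(_ - c) j 0]mxE [(- c) j 0]mxE [RHS]addrC subrK.
  rewrite (le_trans (ler_normD _ _)) // lerD2l.
  rewrite (le_trans (abs_le_l2norm _ _)) //.
  by rewrite -(@ler_pXn2r _ 2) ?nnegrE ?l2norm_ge0 // !sqr_l2norm.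
have [z0' [fz0' Bz0' bz0']] := confine z0 fz0 (lexx _).
pose K := [set u : 'rV[R]_r | vec_le (N *m u^T) b /\ forall j, `|u 0 j| <= C * D]%classic.
have [||u uK umin] :=
  @EVT_min_rV R r (fun u => obj u^T) K _ (@compact_polyhedron_box _ _ N b (C * D)).
- by exists z0'^T; rewrite /K /= trmxK; split=> // j; rewrite mxE.
- by apply: continuous_subspaceT => v; exact: continuous_residual.
rewrite inE in uK; case: uK => fu _.
have inK z : vec_le (N *m z) b -> obj z <= obj z0 -> obj u^T <= obj z.
  move=> fz /(confine z fz)[z' [fz' Bz' bz']].
  have -> : obj z = obj z'^T^T by rewrite trmxK /obj Bz'.
  by apply: umin; rewrite inE /K /= trmxK; split=> // j; rewrite mxE.
exists u^T => // z fz; have [lez|ltz] := leP (obj z) (obj z0); first exact: inK.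
exact: le_trans (inK z0 fz0 (lexx _)) (ltW ltz).
Qed.

End Polyhedra.

Section Duality.
Variable R : realType.

Lemma mulmx_sub_vec p r (N : 'M[R]_(p, r)) (u v : 'cV[R]_r) i :
  (N *m (u - v)) i 0 = (N *m u) i 0 - (N *m v) i 0.
Proof. by rewrite mulmxBr; move: (N *m u) (N *m v) => a b; rewrite !mxE. Qed.

Lemma mulmx_step p r (N : 'M[R]_(p, r)) (u : 'cV[R]_r) t w i :
  (N *m (u + t *: w)) i 0 = (N *m u) i 0 + t * (N *m w) i 0.
Proof.
by rewrite mulmxDr -scalemxAr; move: (N *m u) (N *m w) => a b; rewrite !mxE.
Qed.

Lemma dot_line n (e v : 'cV[R]_n) t :
  dot (e + t *: v) (e + t *: v) = dot e e + 2 * t * dot e v + t ^+ 2 * dot v v.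
Proof. by rewrite dotDl !dotDr !dotZl !dotZr (dotC v e); ring. Qed.

Lemma least_squares_stationary p r s (N : 'M[R]_(p, r)) b (B : 'M[R]_(s, r)) c z0 :
  vec_le (N *m z0) b ->
  exists2 z, vec_le (N *m z) b &
    forall z', vec_le (N *m z') b -> 0 <= dot (B *m z - c) (B *m (z' - z)).
Proof.
move=> /(least_squares_polyhedron B c)[z fz zmin]; exists z => // z' fz'.
set e := B *m z - c; set v := B *m _.
set a := dot e v; pose q := dot v v.
have step t : 0 <= t -> t <= 1 -> 0 <= 2 * t * a + t ^+ 2 * q.
  move=> t0 t1; have fzt : vec_le (N *m (z + t *: (z' - z))) b.
    move=> i; rewrite mulmx_step mulmx_sub_vec.
    have := fz i; have := fz' i; nra.
  have := zmin _ fzt.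
  have -> : B *m (z + t *: (z' - z)) - c = e + t *: v.
    by rewrite mulmxDr -scalemxAr addrAC.
  by rewrite -/e dot_line -/a -/q -addrA lerDl.
have q0 : 0 <= q by exact: dot_ge0.
rewrite leNgt; apply/negP => a0.
have qa : 0 < q - a by lra.
(* This step length stays in [0, 1] even when [q = 0] or [-a > q], where the unconstrained minimiser
   [-a / q] would not. *)
have := step (- a / (q - a)); rewrite divr_ge0 ?ler_pdivrMr ?(ltW qa) ?oppr_ge0 ?(ltW a0) //.
rewrite mul1r => /(_ isT); have -> : - a <= q - a by lra.
move=> /(_ isT); apply/negP; rewrite -ltNge.
have -> : 2 * (- a / (q - a)) * a + (- a / (q - a)) ^+ 2 * q =
    (a / (q - a)) ^+ 2 * (2 * a - q).
  by field; rewrite gt_eqF.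
rewrite pmulr_rlt0; first lra.
by rewrite exprn_even_gt0 //= mulf_eq0 invr_eq0 (lt_eqF a0) (gt_eqF qa).
Qed.

(** Project [c] onto the cone of all [P^T lam + Q^T nu] with [lam >= 0]. The residual [w] lies in
    the polar cone by stationarity, and is either zero or separates [c] from the cone. *)
Lemma farkas p q r (P : 'M[R]_(p, r)) (Q : 'M[R]_(q, r)) (c : 'cV[R]_r) :
  (exists lam : 'cV[R]_p, exists2 nu : 'cV[R]_q,
     forall i, 0 <= lam i 0 & P^T *m lam + Q^T *m nu = c) \/
  (exists w : 'cV[R]_r, [/\ vec_le (P *m w) 0, Q *m w = 0 & 0 < dot c w]).
Proof.
pose N : 'M[R]_(p, p + q) := row_mx (- 1%:M) 0.
pose B := row_mx P^T Q^T.
have NE a b : N *m col_mx a b = - a by rewrite mul_row_col mul0mx addr0 mulNmx mul1mx.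
have BE a b : B *m col_mx a b = P^T *m a + Q^T *m b by rewrite mul_row_col.
have [|z fz stat] := @least_squares_stationary _ _ _ N 0 B c (col_mx 0 0).
  by rewrite NE oppr0.
rewrite -(vsubmxK z) in fz stat *.
set lam := usubmx z in fz stat; set nu := dsubmx z in stat.
rewrite NE in fz.
have lam0 i : 0 <= lam i 0 by have := fz i; rewrite !mxE oppr_le0.
set w := c - B *m col_mx lam nu.
have dir a b : (forall i, 0 <= (lam + a) i 0) -> dot (P *m w) a + dot (Q *m w) b <= 0.
  move=> H; have := stat (col_mx (lam + a) (nu + b)).
  have fab : vec_le (N *m col_mx (lam + a) (nu + b)) 0.
    by move=> i; rewrite NE [leLHS]mxE [leRHS]mxE oppr_le0.
  move=> /(_ fab).
  rewrite opp_col_mx add_col_mx [_ + _ - _]addrAC [nu + _ - _]addrAC !subrr !add0r (BE _ a b).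
  rewrite -[_ - c]opprB -/w dotNl dotDr !(dot_mulr _^T) !trmxK; lra.
have Pw : vec_le (P *m w) 0.
  move=> i; have := dir (delta_mx i 0) 0.
  rewrite dot0r addr0 dotE (bigD1 i) //= big1 => [|j ji]; last first.
    by rewrite [X in _ * X]mxE (negPf ji) mulr0.
  rewrite [delta_mx _ _ i 0]mxE !eqxx mulr1 addr0 => H.
  rewrite [leRHS]mxE; apply: H => j.
  by rewrite mxE addr_ge0 // mxE ler0n.
have Qw : Q *m w = 0.
  apply: dot_eq0; apply/eqP; rewrite eq_le dot_ge0 andbT.
  by have := dir 0 (Q *m w); rewrite dot0r add0r; apply => i; rewrite addr0.
have [w0|w0] := eqVneq w 0; [left|right].
  exists lam, nu => //; rewrite -BE; apply/esym/eqP; rewrite -subr_eq0.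
  by rewrite -/w w0.
exists w; split=> //.
have Plam : 0 <= dot (P *m w) lam.
  have := dir (- lam) 0; rewrite dot0r addr0 dotNr oppr_le0; apply => i.
  by rewrite subrr mxE.
have -> : c = w + (P^T *m lam + Q^T *m nu) by rewrite -BE subrK.
rewrite (dotDl w) (dotDl (P^T *m lam)) !(dot_mull _^T) !trmxK Qw dot0r addr0 [dot lam _]dotC.
rewrite ltr_pwDl // lt_neqAle dot_ge0 andbT eq_sym.
by apply: contra_neq w0; exact: dot_eq0.
Qed.

(** Farkas' lemma for the active rows and the equations: its second alternative would be a descent
    direction, along which the slack of the inactive rows permits a short step. Masking the inactive
    rows gives complementary slackness. *)
Lemma kkt p q r (N1 : 'M[R]_(p, r)) b1 (N2 : 'M[R]_(q, r)) c (z : 'cV[R]_r) :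
  vec_le (N1 *m z) b1 ->
  (forall z', vec_le (N1 *m z') b1 -> N2 *m z' = N2 *m z -> 0 <= dot c (z' - z)) ->
  exists (lam : 'cV[R]_p) (nu : 'cV[R]_q), [/\ forall i, 0 <= lam i 0,
    forall i, (N1 *m z) i 0 != b1 i 0 -> lam i 0 = 0 &
    N1^T *m lam + N2^T *m nu = - c].
Proof.
move=> fz zmin.
pose I := [set i | (N1 *m z) i 0 == b1 i 0].
have [[lam [nu lam0 eqc]]|[w [Iw N2w cw]]] := farkas (row_mask R I *m N1) N2 (- c).
  exists (row_mask R I *m lam), nu; split=> [i|i ni|].
  - by rewrite row_maskE; case: ifP.
  - by rewrite row_maskE inE (negPf ni).
  - by rewrite -eqc trmx_mul tr_diag_mx mulmxA.
(* A step of at most [f i] cannot use up the slack of row [i]; the summand 1 keeps the denominator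
   positive. *)
pose f i := (b1 i 0 - (N1 *m z) i 0) / (1 + `|(N1 *m w) i 0|).
have den i : 0 < 1 + `|(N1 *m w) i 0| by rewrite ltr_pwDl.
pose eps := \big[Num.min/1]_(i | i \notin I) f i.
have eps0 : 0 < eps.
  apply/bigmin_gtP; split=> // i iI; rewrite divr_gt0 // subr_gt0 lt_neqAle fz andbT.
  by rewrite inE in iI.
have feps : vec_le (N1 *m (z + eps *: w)) b1.
  move=> i; rewrite mulmx_step.
  have [iI|iI] := boolP (i \in I).
    have := Iw i; rewrite -mulmxA row_maskE iI [leRHS]mxE => wi.
    by have := fz i; nra.
  have epsi : eps <= f i by exact: bigmin_le_cond.
  have : eps * (1 + `|(N1 *m w) i 0|) <= b1 i 0 - (N1 *m z) i 0.
    by rewrite -ler_pdivlMr.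
  have := ler_norm ((N1 *m w) i 0); nra.
have := zmin _ feps; rewrite mulmxDr -scalemxAr N2w scaler0 addr0 => /(_ erefl).
by rewrite addrC addKr dotZr; move: cw; rewrite dotNl; nra.
Qed.

End Duality.

(** * Robinson's error bound *)

Section Robinson.
Variable R : realType.

Lemma vec_le_eq_col_mx p q r (N1 : 'M[R]_(p, r)) (N2 : 'M[R]_(q, r)) z b1 b2 :
  vec_le (col_mx N1 (col_mx N2 (- N2)) *m z) (col_mx b1 (col_mx b2 (- b2))) <->
  vec_le (N1 *m z) b1 /\ N2 *m z = b2.
Proof.
rewrite !mul_col_mx mulNmx; split=> [/vec_le_col_mx[? /vec_le_col_mx[]]|[fz ->]].
  by split=> //; exact: vec_le_anti.
by apply/vec_le_col_mx; split=> //; apply/vec_le_col_mx; split; exact: vec_le_refl.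
Qed.

(** The point is that the supremum is over a bounded set: for data of norm at most 1, Hoffman's
    bound gives solutions of uniformly bounded size. *)
Lemma le_robinson_mu p1 p2 r (M1 : 'M[R]_(p1, r)) (M2 : 'M[R]_(p2, r)) d :
  (robinson_solutions M1 M2 d !=set0)%classic -> l2norm (col_mx d.1 d.2) <= 1 ->
  inf [set linfnorm u | u in robinson_solutions M1 M2 d]%classic
    <= robinson_mu (@linfnorm R) (@l2norm R) M1 M2.
Proof.
move=> sol0 d1; apply: ub_le_sup; last by exists d.
have [C C0 HC] := hoffman_bound (col_mx M1 (col_mx M2 (- M2))).
exists (C * (p1%:R + (p2%:R + p2%:R))) => _ [[d' d''] /= [[u [u1 u2]] le1] <-].
have [|u' /vec_le_eq_col_mx[u1' u2'] bu'] := HC (col_mx d' (col_mx d'' (- d''))) u.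
  exact/vec_le_eq_col_mx.
have l1 s t (v : 'cV[R]_s) (w : 'cV[R]_t) : l2norm (col_mx v w) <= 1 ->
    l1norm v <= s%:R.
  move=> vw1; rewrite /l1norm -[s in s%:R]card_ord -sumr_const ler_sum // => i _.
  by rewrite (le_trans (abs_le_l2norm v i)) // (le_trans (l2norm_col_mx v w)).
have l1' : l1norm d'' <= p2%:R.
  rewrite /l1norm -[p2 in p2%:R]card_ord -sumr_const ler_sum // => i _.
  by have := abs_le_l2norm (col_mx d' d'') (rshift p1 i); rewrite col_mxEd => /le_trans; apply.
apply: (@le_trans _ _ (linfnorm u')).
  apply: ge_inf; last by exists u'.
  by exists 0 => _ [v _ <-]; exact: linfnorm_ge0.
have D0 : 0 <= C * (p1%:R + (p2%:R + p2%:R)) by rewrite mulr_ge0 // !addr_ge0.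
apply/(linfnorm_leP _ D0) => i; apply: le_trans (bu' i) _.
by rewrite ler_wpM2l // !l1norm_col_mx l1normN !lerD // (l1 _ _ _ _ le1).
Qed.

Lemma identity_rows_mul p q (S : {set 'I_p}) (a : 'M[R]_(p, q)) i j :
  (identity_rows R S *m a) i j = a (enum_val i) j.
Proof. by rewrite /identity_rows mul_rowsub_mx mul1mx mxE. Qed.

(** Together the two sign conditions make [a] vanish on [S]: these are the multipliers admissible
    when the constraints in [S] are inactive. *)
Lemma robinson_signs p q (S : {set 'I_p}) (a : 'cV[R]_p) (b : 'cV[R]_q) :
  vec_le (block_mx (identity_rows R S) (0 : 'M[R]_(_, q)) (- 1%:M) 0 *m col_mx a b) 0
  <-> (forall i, 0 <= a i 0) /\ (forall i, i \in S -> a i 0 <= 0).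
Proof.
rewrite mul_block_col !mul0mx !addr0 mulNmx mul1mx -[X in vec_le _ X]col_mx0.
split=> [/vec_le_col_mx[H1 H2]|[H1 H2]].
  split=> i; first by have := H2 i; rewrite !mxE oppr_le0.
  move=> iS; have := H1 (enum_rank_in iS i).
  by rewrite identity_rows_mul enum_rankK_in // mxE.
apply/vec_le_col_mx; split=> i; last by rewrite !mxE oppr_le0.
by rewrite identity_rows_mul [leRHS]mxE; apply/H2/enum_valP.
Qed.

Lemma le_robinson_sigma m1 m2 l (N1 : 'M[R]_(m1, l)) (N2 : 'M[R]_(m2, l)) S :
  robinson_mu (@linfnorm R) (@l2norm R)
    (block_mx (identity_rows R S) (0 : 'M[R]_(_, m2)) (- 1%:M) 0) (col_mx N1 N2)^T
  <= robinson_sigma (@linfnorm R) (@l2norm R) N1 N2.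
Proof. exact: le_bigmax. Qed.

Lemma robinson_sigma_ge0 m1 m2 l (N1 : 'M[R]_(m1, l)) (N2 : 'M[R]_(m2, l)) :
  0 <= robinson_sigma (@linfnorm R) (@l2norm R) N1 N2.
Proof. exact: bigmax_ge_id. Qed.

(* The point of the polyhedron is the Euclidean projection z of x; the residual
   x - z is a combination of the constraint normals with multipliers that are
   nonnegative and vanish on the set S of inactive constraints, so the maximum
   over S in Robinson's constant provides small multipliers. *)
Lemma robinson_error_bound m1 m2 l (N1 : 'M[R]_(m1, l)) (N2 : 'M[R]_(m2, l))
    b1 b2 z0 x :
  vec_le (N1 *m z0) b1 -> N2 *m z0 = b2 ->
  exists z, [/\ vec_le (N1 *m z) b1, N2 *m z = b2 &
    l2norm (x - z) <= robinson_sigma (@linfnorm R) (@l2norm R) N1 N2 *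
      (\sum_i Num.max ((N1 *m x - b1) i 0) 0 + l1norm (N2 *m x - b2))].
Proof.
move=> fz1 fz2.
have /(least_squares_stationary 1%:M x)[z /vec_le_eq_col_mx[f1 f2] stat] :
    vec_le (col_mx N1 (col_mx N2 (- N2)) *m z0) (col_mx b1 (col_mx b2 (- b2))).
  exact/vec_le_eq_col_mx.
exists z; split=> //.
set W := \sum_i _ + _; set sigma := robinson_sigma _ _ _ _.
have W1 : 0 <= \sum_i Num.max ((N1 *m x - b1) i 0) 0.
  by rewrite sumr_ge0 // => i _; rewrite le_max lexx orbT.
have W0 : 0 <= W by rewrite addr_ge0 // l1norm_ge0.
set rho := l2norm (x - z).
have [rho0|rho0] := eqVneq rho 0.
  by rewrite rho0 mulr_ge0 // robinson_sigma_ge0.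
have {}rho0 : 0 < rho by rewrite lt_neqAle eq_sym rho0 l2norm_ge0.
have [z' fz1' fz2'|lam [nu [lam0 lamI lamE]]] := @kkt _ _ _ _ N1 b1 N2 (z - x) z f1.
  have := stat z'; rewrite !mul1mx; apply; apply/vec_le_eq_col_mx; split=> //.
  by rewrite fz2'.
rewrite opprB in lamE.
pose S := [set i | (N1 *m z) i 0 != b1 i 0].
pose MS := block_mx (identity_rows R S) (0 : 'M[R]_(_, m2)) (- 1%:M) 0.
pose d : 'cV[R]_(#|S| + m1) * 'cV[R]_l := (0, rho^-1 *: (x - z)).
(* A solution [u = (a, b)] writes [(x - z) / rho] as a combination of the constraint normals.
   Pairing with [x - z] gives [rho], and since [N1 z = b1] wherever [a] is nonzero, only the
   residuals of [x] enter. *)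
have le_sol u : robinson_solutions MS (col_mx N1 N2)^T d u -> rho <= linfnorm u * W.
  rewrite -(vsubmxK u) => -[/=/robinson_signs[u0 uS]].
  set a := usubmx u in u0 uS *; set b := dsubmx u; rewrite tr_col_mx mul_row_col => uE.
  have -> : rho = dot a (N1 *m (x - z)) + dot b (N2 *m (x - z)).
    rewrite !dot_mulr -dotDl uE dotZl -sqr_l2norm -/rho expr2 mulKf //.
    by rewrite gt_eqF.
  rewrite mulrDr lerD //.
    rewrite dotE mulr_sumr ler_sum // => i _.
    have au : `|a i 0| <= linfnorm (col_mx a b).
      by have := abs_le_linfnorm (col_mx a b) (lshift m2 i); rewrite col_mxEu.
    have [iS|iS] := boolP (i \in S).
      have -> : a i 0 = 0 by apply/eqP; rewrite eq_le uS // u0.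
      by rewrite mul0r mulr_ge0 ?linfnorm_ge0 // le_max lexx orbT.
    move: iS; rewrite inE negbK => /eqP zi.
    rewrite mulmx_sub_vec zi.
    have -> : (N1 *m x - b1) i 0 = (N1 *m x) i 0 - b1 i 0.
      by move: (N1 *m x) => v; rewrite !mxE.
    set v := _ - _; apply: (@le_trans _ _ (a i 0 * Num.max v 0)).
      by rewrite ler_wpM2l // le_max lexx.
    rewrite ler_wpM2r ?le_max ?lexx ?orbT //.
    exact: le_trans (ler_norm _) au.
  rewrite mulmxBr f2; apply: le_trans (ler_norm _) _; apply: le_trans (dot_le_linf_l1 _ _) _.
  rewrite ler_wpM2r ?l1norm_ge0 //; apply/linfnorm_leP; first exact: linfnorm_ge0.
  by move=> i; have := abs_le_linfnorm (col_mx a b) (rshift m1 i); rewrite col_mxEd.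
have sol0 : (robinson_solutions MS (col_mx N1 N2)^T d !=set0)%classic.
  exists (rho^-1 *: col_mx lam nu); split=> /=.
    rewrite scale_col_mx; apply/robinson_signs; split=> i.
      by rewrite mxE mulr_ge0 // invr_ge0 ltW.
    by rewrite inE => iS; rewrite mxE lamI // mulr0.
  by rewrite tr_col_mx scale_col_mx mul_row_col -!scalemxAr -scalerDr lamE.
have W_gt0 : 0 < W.
  case: sol0 => u /le_sol; rewrite lt_neqAle W0 andbT; apply: contraTneq => <-.
  by rewrite mulr0 -ltNge.
rewrite -ler_pdivrMr //; apply: le_trans (le_robinson_sigma _ _ S).
apply: le_trans (le_robinson_mu sol0 _).
  apply: lb_le_inf; first by case: sol0 => u su; exists (linfnorm u), u.
  by move=> _ [u /le_sol su <-]; rewrite ler_pdivrMr.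
rewrite -(@ler_pXn2r _ 2) ?nnegrE ?l2norm_ge0 // sqr_l2norm dot_col_mx dot0l add0r.
by rewrite dotZl dotZr -sqr_l2norm -/rho expr2 mulKf ?mulVf ?expr1n ?gt_eqF.
Qed.

End Robinson.

(** * Linear programming duality *)

Section LinearProgramming.
Variable R : realType.

Lemma dot_const1 n (u : 'cV[R]_n) : dot (const_mx 1) u = \sum_i u i 0.
Proof. by rewrite dotE; apply: eq_bigr => i _; rewrite mxE mul1r. Qed.

(** Where the objective is nonnegative, minimising it is the same as minimising its square, a
    least-squares problem; this gives attainment, and [kkt] gives the multipliers. *)
Lemma lp_strong_duality p r (N : 'M[R]_(p, r)) b c (z0 : 'cV[R]_r) :
  vec_le (N *m z0) b ->
  (forall z, vec_le (N *m z) b -> 0 <= dot c z) ->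
  exists (z : 'cV[R]_r) (lam : 'cV[R]_p), [/\ vec_le (N *m z) b, forall i, 0 <= lam i 0,
    N^T *m lam = - c & dot c z + dot lam b = 0].
Proof.
move=> fz0 bnd.
have [z fz zmin] := least_squares_polyhedron c^T 0 fz0.
have min_c z' : vec_le (N *m z') b -> 0 <= dot c (z' - z).
  move=> fz'; have := zmin _ fz'.
  have sqE u : dot (c^T *m u) (c^T *m u) = dot c u ^+ 2 by rewrite dotE big_ord1.
  rewrite !subr0 !sqE ler_pXn2r ?nnegrE //; [|exact: bnd..].
  by rewrite dotDr dotNr subr_ge0.
have [z' fz' _|lam [nu [lam0 lamI]]] := @kkt _ _ 0 _ N b 0 c z fz.
  exact: min_c.
rewrite linear0 mul0mx addr0 => lamE; exists z, lam; split=> //.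
have -> : dot c z = - dot lam (N *m z) by rewrite dot_mulr lamE dotNl opprK.
rewrite addrC -dotNr -dotDr dotE big1 // => i _.
have [bi|bi] := eqVneq ((N *m z) i 0) (b i 0); last by rewrite lamI // mul0r.
by move: bi; move: (N *m z) => u bi; rewrite !mxE bi subrr mulr0.
Qed.

(* The linear program minimises the sum of t subject to |z| <= t and A z = A x. *)
Lemma l1_min_certificate m n (A : 'M[R]_(m, n)) (x : 'cV[R]_n) :
  (forall z, A *m z = A *m x -> l1norm x <= l1norm z) ->
  exists u : 'cV[R]_m, forall i, [/\ `|(A^T *m u) i 0| <= 1,
    0 < x i 0 -> (A^T *m u) i 0 = 1 & x i 0 < 0 -> (A^T *m u) i 0 = -1].
Proof.
move=> xmin.
pose N : 'M[R]_(n + n, n + n) := block_mx 1%:M (- 1%:M) (- 1%:M) (- 1%:M).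
pose E : 'M[R]_(m, n + n) := row_mx A 0.
pose t : 'cV[R]_n := \col_i `|x i 0|.
have NE (z s : 'cV[R]_n) : N *m col_mx z s = col_mx (z - s) (- z - s).
  by rewrite mul_block_col !mulNmx !mul1mx.
have EE (z s : 'cV[R]_n) : E *m col_mx z s = A *m z.
  by rewrite mul_row_col mul0mx addr0.
have NleP (z s : 'cV[R]_n) : vec_le (N *m col_mx z s) 0 <-> forall i, `|z i 0| <= s i 0.
  rewrite NE -[X in vec_le _ X]col_mx0; split=> [/vec_le_col_mx[H1 H2] i|H].
    have := H1 i; have := H2 i; rewrite !mxE ler_norml; lra.
  by apply/vec_le_col_mx; split=> i; have := H i; rewrite !mxE ler_norml; lra.
have [||lam [nu [lam0 lamI lamE]]] := @kkt _ _ _ _ N 0 E (col_mx 0 (const_mx 1)) (col_mx x t).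
- by apply/NleP => i; rewrite mxE.
- move=> z; rewrite -(vsubmxK z) => /NleP zt; rewrite !EE => /xmin xz.
  rewrite opp_col_mx add_col_mx dot_col_mx dot0l add0r dotDr dotNr subr_ge0 !dot_const1.
  apply: (@le_trans _ _ (l1norm x)); first by apply: ler_sum => i _; rewrite mxE.
  by apply: le_trans xz _; apply: ler_sum.
(* With multipliers [a] of [z <= t] and [b] of [-z <= t], stationarity reads [A^T (-nu) = a - b] and
   [a + b = 1]; complementary slackness removes [b] where [x] is positive and [a] where it is
   negative. *)
exists (- nu) => i.
move: lamE lam0 lamI; rewrite -(vsubmxK lam).
move: (usubmx lam) (dsubmx lam) => a b.
have NT : N^T = N by rewrite tr_block_mx [(- _)^T]linearN /= trmx1.
rewrite NT !NE tr_row_mx mul_col_mx trmx0 !mul0mx add_col_mx opp_col_mx oppr0 addr0.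
move=> /eq_col_mx[/colP/(_ i) e1 /colP/(_ i) e2] lam0 lamI.
have := lam0 (lshift n i); have := lam0 (rshift n i); rewrite col_mxEu col_mxEd => b0 a0.
have := lamI (lshift n i); have := lamI (rshift n i).
rewrite !col_mxEu !col_mxEd mulmxN; move: e1 e2; move: (A^T *m nu) => v.
rewrite !mxE => e1 e2 bI aI; split.
- by rewrite ler_norml; lra.
- move=> xi; have b_eq0 : b i 0 = 0 by apply: bI; rewrite gtr0_norm //; apply/eqP; lra.
  by lra.
- move=> xi; have a_eq0 : a i 0 = 0 by apply: aI; rewrite ltr0_norm //; apply/eqP; lra.
  by lra.
Qed.

End LinearProgramming.

(** * The optimality system of the Dantzig selector *)

Section DantzigSystem.
Variables (R : realType) (m n : nat) (A : 'M[R]_(m, n)) (y : 'cV[R]_m) (tau : R).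

Local Notation e := (const_mx 1 : 'cV[R]_n).
Local Notation M1 := (DS_M1 A A 1).
Local Notation M2 := (DS_M2 A A y tau).

(* The column blocks of M^1 in the order of the paper; the right-hand side b
   turns M^1 z <= b, M^2 z = 0 into the optimality system of the Dantzig selector. *)
Definition DS_point (x t : 'cV[R]_n) (xi : 'cV[R]_1) (v w1 w2 : 'cV[R]_n)
    (w3 : 'cV[R]_1) (w4 w5 w6 w7 : 'cV[R]_n) :=
  col_mx x (col_mx t (col_mx xi (col_mx v (col_mx w1 (col_mx w2 (col_mx w3
    (col_mx w4 (col_mx w5 (col_mx w6 w7))))))))).

Lemma mul_row_DS_point p (a1 a2 : 'M[R]_(p, n)) (a3 : 'M[R]_(p, 1))
    (a4 a5 a6 : 'M[R]_(p, n)) (a7 : 'M[R]_(p, 1)) (a8 a9 a10 a11 : 'M[R]_(p, n))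
    x t xi v w1 w2 w3 w4 w5 w6 w7 :
  row_mx a1 (row_mx a2 (row_mx a3 (row_mx a4 (row_mx a5 (row_mx a6 (row_mx a7
    (row_mx a8 (row_mx a9 (row_mx a10 a11)))))))))
    *m DS_point x t xi v w1 w2 w3 w4 w5 w6 w7 =
  a1 *m x + (a2 *m t + (a3 *m xi + (a4 *m v + (a5 *m w1 + (a6 *m w2 + (a7 *m w3
    + (a8 *m w4 + (a9 *m w5 + (a10 *m w6 + a11 *m w7))))))))).
Proof. by rewrite !mul_row_col. Qed.

Definition DS_rhs : 'cV[R]_(n + (n + (1 + (n + (n + (n + (n + (n + (1 + (n +
    (n + (n + (1 + (n + (n + (n + n)))))))))))))))) :=
  let c := A^T *m y in
  col_mx 0 (col_mx 0 (col_mx tau%:M (col_mx c (col_mx (- c) (col_mx c (col_mx (- c)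
    (col_mx e (col_mx 0 (col_mx 0 (col_mx 0 (col_mx 0 (col_mx 0 (col_mx 0
    (col_mx 0 (col_mx 0 0))))))))))))))).

Lemma mul_DS_M1 x t xi v w1 w2 w3 w4 w5 w6 w7 :
  let g := A^T *m A *m x in
  M1 *m DS_point x t xi v w1 w2 w3 w4 w5 w6 w7 =
  col_mx (x - t) (col_mx (- x - t) (col_mx xi (col_mx (g - e *m xi)
    (col_mx (- g - e *m xi) (col_mx (g - v) (col_mx (- g - v) (col_mx (w1 + w2)
    (col_mx (- w3 + (e^T *m w4 + e^T *m w5)) (col_mx (w6 + w7) (col_mx (- w1)
    (col_mx (- w2) (col_mx (- w3) (col_mx (- w4) (col_mx (- w5)
    (col_mx (- w6) (- w7)))))))))))))))).
Proof.
rewrite /= /DS_M1 subrr !scale0r.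
do 16! (rewrite mul_col_mx; congr (col_mx _ _); [
  by rewrite mul_row_DS_point ?mulNmx ?mul0mx ?mul1mx ?oppr0 ?addr0 ?add0r |]).
by rewrite mul_row_DS_point ?mulNmx ?mul0mx ?mul1mx ?addr0 ?add0r.
Qed.

Lemma mul_DS_M2 x t xi v w1 w2 w3 w4 w5 w6 w7 :
  let h := w4 + (- w5 + (- w6 + w7)) in
  M2 *m DS_point x t xi v w1 w2 w3 w4 w5 w6 w7 =
  col_mx (- w1 + w2 + A^T *m A *m h) (e^T *m t + tau%:M *m w3 - y^T *m A *m h).
Proof.
rewrite /= /DS_M2 mul_col_mx !mul_row_DS_point !mul0mx !add0r.
by congr col_mx; rewrite ?mulNmx ?mul1mx !mulmxDr !mulmxN ?opprD ?opprK ?addrA.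
Qed.

(** The dual of (DS) maximises [dot y (A h) - tau |h|_1] subject to [|A^T A h|_oo <= 1]. The
    inequality is Hölder's, applied to both terms of [dot (A^T A h) x - dot (A^T (A x - y)) h]. *)
Lemma DS_weak_duality x h : DS_feasible A y tau x ->
  linfnorm (A^T *m A *m h) <= 1 ->
  dot y (A *m h) <= l1norm x + tau * l1norm h.
Proof.
move=> fx hle.
have -> : dot y (A *m h) = dot (A^T *m A *m h) x - dot (A^T *m (A *m x - y)) h.
  by rewrite -mulmxA !(dot_mull A^T) trmxK dotDl dotNl (dotC (A *m x)); ring.
have := dot_le_linf_l1 (A^T *m A *m h) x; have := dot_le_linf_l1 (A^T *m (A *m x - y)) h.
have := l1norm_ge0 x; have := l1norm_ge0 h; rewrite /DS_feasible in fx.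
rewrite !ler_norml => h0 x0 /andP[H1 _] /andP[_ H2].
have : linfnorm (A^T *m A *m h) * l1norm x <= 1 * l1norm x by exact: ler_wpM2r.
have : linfnorm (A^T *m (A *m x - y)) * l1norm h <= tau * l1norm h by exact: ler_wpM2r.
lra.
Qed.

Definition pos_part_sum p (u : 'cV[R]_p) : R := \sum_i Num.max (u i 0) 0.

Lemma pos_part_sum_col_mx p q (u : 'cV[R]_p) (v : 'cV[R]_q) :
  pos_part_sum (col_mx u v) = pos_part_sum u + pos_part_sum v.
Proof.
rewrite /pos_part_sum big_split_ord; congr (_ + _); apply: eq_bigr => i _.
  by rewrite col_mxEu.
by rewrite col_mxEd.
Qed.

Lemma pos_part_sum_ge0 p (u : 'cV[R]_p) : 0 <= pos_part_sum u.
Proof. by rewrite sumr_ge0 // => i _; rewrite le_max lexx orbT. Qed.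

Lemma pos_part_sum_eq0 p (u : 'cV[R]_p) : pos_part_sum u = 0 <-> vec_le u 0.
Proof.
split=> [/psumr_eq0P H i|H]; last first.
  by apply: big1 => i _; apply/max_idPr; have := H i; rewrite mxE.
by rewrite mxE; apply/max_idPr/H => // j _; rewrite le_max lexx orbT.
Qed.

Lemma DS_residual x h : linfnorm (A^T *m A *m h) <= 1 ->
  exists2 z, usubmx z = x &
    pos_part_sum (M1 *m z - DS_rhs) + l1norm (M2 *m z) =
    Num.max (linfnorm (A^T *m (A *m x - y)) - tau) 0
      + `|l1norm x + tau * l1norm h - dot y (A *m h)|.
Proof.
set g := A^T *m A *m h; set r := linfnorm (_ *m (A *m x - y)) => /(linfnorm_leP _ ler01) gle.
pose t : 'cV[R]_n := \col_i `|x i 0|.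
pose pos (u : 'cV[R]_n) : 'cV[R]_n := \col_i Num.max (u i 0) 0.
pose neg (u : 'cV[R]_n) : 'cV[R]_n := \col_i Num.max (- u i 0) 0.
have posneg u : pos u - neg u = u.
  apply/colP => i; rewrite !mxE; have [ui|/ltW ui] := leP 0 (u i 0).
    by rewrite (max_idPr _) ?oppr_le0 // subr0.
  by rewrite (max_idPl _) ?oppr_ge0 // sub0r opprK.
have posDneg u i : (pos u + neg u) i 0 = `|u i 0|.
  rewrite !mxE; have [ui|/ltW ui] := leP 0 (u i 0).
    by rewrite (max_idPr _) ?oppr_le0 // addr0 ger0_norm.
  by rewrite (max_idPl _) ?oppr_ge0 // add0r ler0_norm.
have pos_ge0 u : vec_le (- pos u) 0 by move=> i; rewrite !mxE oppr_le0 le_max lexx orbT.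
have neg_ge0 u : vec_le (- neg u) 0 by move=> i; rewrite !mxE oppr_le0 le_max lexx orbT.
(* Both [xi] and [v] carry the residual norm [r], and signed vectors are split into positive and
   negative parts; only the row [xi <= tau] and the duality gap can then fail. *)
exists (DS_point x t r%:M (const_mx r) (pos g) (neg g) (l1norm h)%:M (pos h) (neg h) 0 0).
  by rewrite /DS_point col_mxKu.
rewrite mul_DS_M1 mul_DS_M2 /DS_rhs !opp_col_mx !add_col_mx !pos_part_sum_col_mx.
rewrite l1norm_col_mx !subr0 !oppr0 !addr0 posneg.
have -> : (const_mx 1 : 'cV[R]_n) *m r%:M = const_mx r.
  by apply/colP => i; rewrite !mxE big_ord1 !mxE mul1r.
have gx : A^T *m A *m x = A^T *m (A *m x - y) + A^T *m y.
  by rewrite -mulmxDr subrK mulmxA.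
have qle i : `|(A^T *m (A *m x - y)) i 0| <= r by exact: abs_le_linfnorm.
have le1 : vec_le (A^T *m A *m x - const_mx r - A^T *m y) 0.
  rewrite gx addrAC addrK => i; rewrite !mxE; have := qle i; rewrite ler_norml mxE.
  lra.
have le2 : vec_le (- (A^T *m A *m x) - const_mx r + A^T *m y) 0.
  rewrite gx opprD addrAC subrK => i; rewrite !mxE; have := qle i; rewrite ler_norml mxE.
  lra.
have l1h : (const_mx 1)^T *m pos h + (const_mx 1)^T *m neg h = (l1norm h)%:M.
  rewrite -mulmxDr; apply/colP => i; rewrite ord1 -/(dot _ _) dot_const1 !mxE mulr1n.
  by apply: eq_bigr => j _; rewrite posDneg.
rewrite opprK l1h addNr.
have z0 p (u : 'cV[R]_p) : vec_le u 0 -> pos_part_sum u = 0 by move/pos_part_sum_eq0.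
rewrite (z0 _ (x - t)); last by move=> i; rewrite !mxE subr_le0 ler_norm.
rewrite (z0 _ (- x - t)); last by move=> i; rewrite !mxE subr_le0 ler_normr lexx orbT.
rewrite (z0 _ _ le1) (z0 _ _ le2) !(z0 _ (- pos _)) // !(z0 _ (- neg _)) //.
rewrite (z0 _ (- (l1norm h)%:M)); last first.
  by move=> i; rewrite !mxE ord1 mulr1n oppr_le0 l1norm_ge0.
rewrite (z0 _ (pos g + neg g - const_mx 1)); last first.
  by move=> i; rewrite [leLHS]mxE posDneg; move: (g i 0) (gle i) => c cle; rewrite !mxE subr_le0.
rewrite !(z0 _ 0); [|exact: vec_le_refl..].
rewrite !addr0 !add0r {1}/pos_part_sum big_ord1 !mxE !mulr1n.
have -> : - pos g + neg g = - g by rewrite -[in RHS](posneg g) opprB addrC.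
rewrite addNr.
have -> : l1norm (0 : 'cV[R]_n) = 0 by rewrite /l1norm big1 // => i _; rewrite mxE normr0.
rewrite add0r {1}/l1norm big_ord1; congr (_ + `|_|).
have entry (a b c : 'M[R]_1) : (a + b - c) 0 0 = a 0 0 + b 0 0 - c 0 0 by rewrite !mxE.
rewrite -mulmxA entry -!/(dot _ _) dot_const1; congr (_ + _ - _).
  by apply: eq_bigr => i _; rewrite mxE.
by rewrite mul_scalar_mx !mxE mulr1n.
Qed.

(** The last row of [M^2] closes the duality gap, so weak duality makes the l1 norm of the [x]-part
    a lower bound for all feasible points. *)
Lemma DS_system_optimal z : 0 <= tau ->
  vec_le (M1 *m z) DS_rhs -> M2 *m z = 0 -> DS_optimal A y tau (usubmx z).
Proof.
move=> tau0.
have [x [t [xi [v [w1 [w2 [w3 [w4 [w5 [w6 [w7 ->]]]]]]]]]]] : exists x t xi v w1 w2 w3 w4 w5 w6 w7,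
    z = DS_point x t xi v w1 w2 w3 w4 w5 w6 w7.
  by do 11! eexists; rewrite /DS_point; do 10! (rewrite -[LHS]vsubmxK; congr col_mx).
rewrite mul_DS_M1 mul_DS_M2 /DS_rhs /DS_point col_mxKu.
case/vec_le_col_mx=> xt /vec_le_col_mx[xt' /vec_le_col_mx[xitau]].
case/vec_le_col_mx=> gxi /vec_le_col_mx[gxi' /vec_le_col_mx[_ /vec_le_col_mx[_]]].
case/vec_le_col_mx=> w12 /vec_le_col_mx[w345 /vec_le_col_mx[w67]].
case/vec_le_col_mx=> w1p /vec_le_col_mx[w2p /vec_le_col_mx[_]].
case/vec_le_col_mx=> w4p /vec_le_col_mx[w5p /vec_le_col_mx[w6p w7p]].
set h := w4 + _; rewrite -[X in _ = X -> _]col_mx0 => /eq_col_mx[gh gap].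
have fx : DS_feasible A y tau x.
  apply/linfnorm_leP => // i; rewrite mulmxBr mulmxA.
  have e1 : (const_mx 1 *m xi : 'cV[R]_n) i 0 = xi 0 0.
    by rewrite mxE big_ord1 mxE mul1r.
  have := gxi i; have := gxi' i; have := xitau 0.
  move: (A^T *m A *m x) (A^T *m y) (const_mx 1 *m xi) e1 => a b c e1.
  rewrite !mxE e1 mulr1n ler_norml; lra.
split=> // x' fx'.
have hw i : `|h i 0| <= w4 i 0 + w5 i 0.
  have := w67 i; have := w4p i; have := w5p i; have := w6p i; have := w7p i.
  by rewrite !mxE ler_norml; lra.
have h_le : l1norm h <= w3 0 0.
  have /= := w345 0; rewrite -mulmxDr [leLHS]mxE [leRHS]mxE -/(dot _ _) dot_const1 mxE.
  rewrite addrC subr_le0; apply: le_trans; apply: ler_sum => i _.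
  by rewrite [leRHS]mxE.
have gle : linfnorm (A^T *m A *m h) <= 1.
  apply/linfnorm_leP => // i.
  have := w12 i; have := w1p i; have := w2p i; move/colP/(_ i): gh.
  by move: (A^T *m A *m h) => g; rewrite !mxE ler_norml; lra.
have := DS_weak_duality fx' gle.
have xle : l1norm x <= \sum_i t i 0.
  by apply: ler_sum => i _; have := xt i; have := xt' i; rewrite !mxE ler_norml; lra.
have {}gap : \sum_i t i 0 + tau * w3 0 0 - dot y (A *m h) = 0.
  move/matrixP/(_ 0 0): gap; rewrite -mulmxA mul_scalar_mx.
  have entry (a b c : 'M[R]_1) : (a + b - c) 0 0 = a 0 0 + b 0 0 - c 0 0 by rewrite !mxE.
  by rewrite entry -!/(dot _ _) dot_const1 !mxE.
have : tau * l1norm h <= tau * w3 0 0 by exact: ler_wpM2l.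
lra.
Qed.

(* Linear programming duality for minimising the sum of t subject to
   |x| <= t and |A^T (A x - y)| <= tau; A A^T is invertible, so the constraints are
   satisfied by a solution of A x = y. *)
Lemma DS_dual_attained x0 : 0 <= tau -> A *m x0 = y ->
  exists x h, [/\ DS_feasible A y tau x, linfnorm (A^T *m A *m h) <= 1 &
    l1norm x + tau * l1norm h = dot y (A *m h)].
Proof.
move=> tau0 Ax0.
have [c cE] : exists c, c = A^T *m y by exists (A^T *m y).
pose G := A^T *m A; pose tt : 'cV[R]_n := const_mx tau.
pose N : 'M[R]_(n + (n + (n + n)), n + n) :=
  col_mx (row_mx 1%:M (- 1%:M)) (col_mx (row_mx (- 1%:M) (- 1%:M))
    (col_mx (row_mx G 0) (row_mx (- G) 0))).
pose b : 'cV[R]_(n + (n + (n + n))) := col_mx 0 (col_mx 0 (col_mx (tt + c) (tt - c))).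
have NleP x t : vec_le (N *m col_mx x t) b <->
    (forall i, `|x i 0| <= t i 0) /\ DS_feasible A y tau x.
  rewrite !mul_col_mx !mul_row_col !mulNmx !mul0mx !mul1mx !addr0.
  have gx i : (A^T *m (A *m x - y)) i 0 = (G *m x) i 0 - c i 0.
    by rewrite mulmxBr mulmxA -/G -cE; move: (G *m x) => u; rewrite !mxE.
  split=> [/vec_le_col_mx[H1 /vec_le_col_mx[H2 /vec_le_col_mx[H3 H4]]]
          |[H1 /(linfnorm_leP _ tau0) H2]].
    split; last apply/linfnorm_leP => // i; last rewrite gx.
      by move=> i; have := H1 i; have := H2 i; rewrite !mxE ler_norml; lra.
    have := H3 i; have := H4 i; move: (G *m x) => u; rewrite !mxE ler_norml; lra.
  apply/vec_le_col_mx; split=> [i|].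
    by have := H1 i; rewrite !mxE ler_norml; lra.
  apply/vec_le_col_mx; split=> [i|].
    by have := H1 i; rewrite !mxE ler_norml; lra.
  apply/vec_le_col_mx; split=> i; have := H2 i; rewrite gx; move: (G *m x) => u;
    rewrite !mxE ler_norml; lra.
pose t0 : 'cV[R]_n := \col_i `|x0 i 0|.
have [||z [lam [fz lam0 lamE gap]]] := @lp_strong_duality _ _ _ N b (col_mx 0 e) (col_mx x0 t0).
- apply/NleP; split=> [i|]; first by rewrite mxE.
  by apply/linfnorm_leP => // i; rewrite Ax0 subrr mulmx0 mxE normr0.
- move=> z; rewrite -(vsubmxK z) => /NleP[zt _].
  rewrite dot_col_mx dot0l add0r dot_const1 sumr_ge0 // => i _.
  by apply: le_trans (zt i).
move: fz gap; rewrite -(vsubmxK z); set x := usubmx z; set t := dsubmx z.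
move=> /NleP[xt fx].
have [a1 [a2 [a3 [a4 lam_eq]]]] : exists a1 a2 a3 a4, lam = col_mx a1 (col_mx a2 (col_mx a3 a4)).
  by do 4! eexists; do 3! (rewrite -[LHS]vsubmxK; congr col_mx).
move: lam0 lamE; rewrite {}lam_eq => lam0 lamE gap.
have GT : G^T = G by rewrite trmx_mul trmxK.
have trN p q (X : 'M[R]_(p, q)) : (- X)^T = - X^T by rewrite linearN.
have [e1 e2] : a1 - a2 + G *m (a3 - a4) = 0 /\ a1 + a2 = e.
  move: lamE; rewrite !tr_col_mx !tr_row_mx !mul_row_col !mul_col_mx !trN !trmx1.
  rewrite !trmx0 GT !mul0mx !mulNmx !mul1mx !add_col_mx opp_col_mx oppr0.
  move=> /eq_col_mx[E1 E2]; split; first by rewrite mulmxBr -addrA.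
  by apply: oppr_inj; rewrite -E2 !addr0 opprD.
have a_ge0 i : [/\ 0 <= a1 i 0, 0 <= a2 i 0, 0 <= a3 i 0 & 0 <= a4 i 0].
  have := lam0 (lshift _ i); have := lam0 (rshift _ (lshift _ i)).
  have := lam0 (rshift _ (rshift _ (lshift _ i))).
  have := lam0 (rshift _ (rshift _ (rshift _ i))).
  by rewrite !(col_mxEu, col_mxEd).
(* [a3] and [a4] are the multipliers of the upper and lower halves of [|A^T (A x - y)| <= tau].
   Strong duality gives one inequality between the two values, weak duality the other. *)
pose h := a4 - a3.
have hle : linfnorm (A^T *m A *m h) <= 1.
  apply/linfnorm_leP => // i; have [p1 p2 _ _] := a_ge0 i.
  have -> : A^T *m A *m h = a1 - a2.
    by apply/eqP; rewrite eq_sym -subr_eq0 -mulmxN opprB e1.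
  by move/colP/(_ i): e2; rewrite !mxE ler_norml; lra.
exists x, h; split=> //; apply/eqP; rewrite eq_le DS_weak_duality // andbT.
have xle : l1norm x <= \sum_i t i 0 by exact: ler_sum.
have hle1 : l1norm h <= dot e a3 + dot e a4.
  rewrite -dotDr dot_const1; apply: ler_sum => i _; have [_ _ p3 p4] := a_ge0 i.
  by rewrite !mxE ler_norml; lra.
have : tau * l1norm h <= tau * (dot e a3 + dot e a4) by exact: ler_wpM2l.
move: gap; rewrite /b !dot_col_mx !dot0l !dot0r !add0r dot_const1 !dotDr dotNr.
have dtt a : dot a tt = tau * dot e a.
  have -> : tt = tau *: e by apply/colP => i; rewrite !mxE mulr1.
  by rewrite dotZr dotC.
have -> : dot y (A *m h) = dot a4 c - dot a3 c.
  by rewrite dot_mulr -cE -[dot a4 c]dotC -[dot a3 c]dotC -dotNr -dotDr.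
rewrite !dtt; lra.
Qed.

End DantzigSystem.

(** * Basic solutions and the constant c_A *)

Section BasicSolutions.
Variables (R : realType) (m n : nat) (A : 'M[R]_(m, n)).

Lemma l1norm_mulmx p q (Q : 'M[R]_(p, q)) (z : 'cV[R]_q) : linfnorm z <= 1 ->
  l1norm (Q *m z) <= \sum_i \sum_j `|Q i j|.
Proof.
move=> z1; apply: ler_sum => i _; rewrite mxE (le_trans (ler_norm_sum _ _ _)) //.
apply: ler_sum => j _; rewrite normrM ler_piMr //.
exact: le_trans (abs_le_linfnorm z j) z1.
Qed.

Lemma le_opnorm_inf_1 p q (Q : 'M[R]_(p, q)) z : linfnorm z <= 1 ->
  l1norm (Q *m z) <= opnorm_inf_1 Q.
Proof.
move=> z1; apply: ub_le_sup; last by exists z.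
by exists (\sum_i \sum_j `|Q i j|) => _ [u /= u1 <-]; exact: l1norm_mulmx.
Qed.

Lemma le_DS_c (G : {set 'I_n}) (hG : #|G| = m) :
  column_submatrix A hG \in unitmx ->
  opnorm_inf_1 (invmx (column_submatrix A hG) *m invmx (A *m A^T) *m A) <= DS_c A.
Proof.
move=> uG; apply: ub_le_sup; last by exists G, hG.
pose Q (H : {set 'I_n}) (hH : #|H| = m) :=
  invmx (column_submatrix A hH) *m invmx (A *m A^T) *m A.
(* As a function of the set alone, the norm takes finitely many values, which bounds the
   supremum. *)
pose bnd (H : {set 'I_n}) :=
  if pselect (#|H| = m) is left hH then opnorm_inf_1 (Q H hH) else 0.
have bndE (H : {set 'I_n}) (hH : #|H| = m) : bnd H = opnorm_inf_1 (Q H hH).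
  rewrite /bnd; case: pselect => [hH'|//].
  by have -> : hH' = hH by exact: eq_irrelevance.
exists (\sum_H `|bnd H|) => _ [H [hH [_ ->]]].
rewrite -/(Q H hH) -bndE (bigD1 H) //= (le_trans (ler_norm _)) // lerDl.
by rewrite sumr_ge0.
Qed.

Lemma DS_c_ge0 : 0 <= DS_c A.
Proof.
rewrite /DS_c; set V := (X in sup X).
have [[v Vv]|V0] := pselect (exists v, V v); last first.
  by rewrite sup_out // => -[[v Vv] _]; apply: V0; exists v.
have [G [hG [uG _]]] := Vv; apply: le_trans (le_DS_c uG).
apply: le_trans (le_opnorm_inf_1 _ (z := 0) _); first exact: l1norm_ge0.
by apply/linfnorm_leP => // i; rewrite mxE normr0.
Qed.

Hypothesis rankA : \rank A = m.

Lemma gram_unitmx : A *m A^T \in unitmx.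
Proof.
rewrite -row_free_unit; apply: inj_row_free => v vAA.
have Av0 : A^T *m v^T = 0.
  apply: dot_eq0; rewrite dot_mull trmxK mulmxA.
  by rewrite /dot trmxK !mulmxA -(mulmxA v A) vAA mul0mx mxE.
have /row_free_injr : row_free A by rewrite /row_free rankA.
by move=> injA; apply: injA; rewrite /= mul0mx -[LHS]trmxK trmx_mul Av0 trmx0.
Qed.

Lemma exists_basis : exists (G : {set 'I_n}) (hG : #|G| = m),
  column_submatrix A hG \in unitmx.
Proof.
have full : row_full A^T by rewrite /row_full mxrank_tr rankA.
pose f := fullrankfun full.
pose G := [set f i | i : 'I_m].
have hG : #|G| = m by rewrite card_imset ?card_ord //; exact: fullrankfun_inj.
exists G, hG; rewrite -unitmx_tr -row_full_unit -sub1mx.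
have /submx_trans : (1%:M <= rowsub f A^T)%MS by rewrite sub1mx fullrowsub_full.
apply; apply/row_subP => i; rewrite row_rowsub.
have fiG : f i \in G by apply/imsetP; exists i.
have -> : row (f i) A^T =
    row (cast_ord hG (enum_rank_in fiG (f i))) (column_submatrix A hG)^T.
  by apply/rowP => j; rewrite !mxE cast_ordK enum_rankK_in.
exact: row_sub.
Qed.

(** This is where the formula for c_A comes from: with [zeta = A^T u], the vector supported on a
    basis [G] with entries [A_G^-1 (A A^T)^-1 A zeta] is mapped to [u] by [A]. The factor
    [colsub f 1%:M] extends it by zero outside [G]. *)
Lemma DS_c_preimage (u : 'cV[R]_m) : linfnorm (A^T *m u) <= 1 ->
  exists2 h, A^T *m A *m h = A^T *m u & l1norm h <= DS_c A.
Proof.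
move=> z1; have [G [hG uG]] := exists_basis.
pose f (i : 'I_m) : 'I_n := enum_val (cast_ord (esym hG) i).
pose g := invmx (column_submatrix A hG) *m invmx (A *m A^T) *m A *m (A^T *m u).
exists (colsub f 1%:M *m g).
  rewrite -mulmxA; congr (A^T *m _); rewrite mulmxA mulmx_colsub mulmx1.
  rewrite -[colsub f A]/(column_submatrix A hG) /g !mulmxA mulmxV // mul1mx.
  by rewrite -!(mulmxA _ A A^T) mulVmx ?gram_unitmx // mul1mx.
apply: (@le_trans _ _ (l1norm g)).
  apply: (@le_trans _ _ (\sum_i \sum_j (i == f j)%:R * `|g j 0|)).
    apply: ler_sum => i _; rewrite mxE (le_trans (ler_norm_sum _ _ _)) // ler_sum // => j _.
    by rewrite normrM !mxE normr_nat.
  rewrite exchange_big /= ler_sum // => j _; rewrite -mulr_suml (bigD1 (f j)) //= eqxx.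
  by rewrite big1 ?addr0 ?mul1r // => i /negPf ->.
exact: le_trans (le_opnorm_inf_1 _ z1) (le_DS_c uG).
Qed.

End BasicSolutions.

(** * Best k-term approximation in the l1 norm *)

Section BestApproximation.
Variables (R : realType) (n : nat).

Lemma best_approx_l1_attained k (x : 'cV[R]_n) :
  exists2 S : {set 'I_n}, (#|S| <= k)%N & l1norm_on (~: S) x <= best_approx_l1 k x.
Proof.
have P0 : (#|finset.set0 : {set 'I_n}| <= k)%N by rewrite cards0.
have [S Sk Smin] := @arg_minP _ _ _ (finset.set0 : {set 'I_n})
  [pred S : {set 'I_n} | (#|S| <= k)%N]
  (fun S : {set 'I_n} => l1norm_on (~: S) x) P0.
exists S => //; apply: lb_le_inf.
  exists (l1norm (x - 0)), 0 => //=; rewrite /l0norm.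
  by rewrite (_ : [set _ | _] = finset.set0) ?cards0 //; apply/setP => i; rewrite !inE mxE eqxx.
move=> _ [u /= uk <-]; apply: le_trans (Smin _ uk) _.
rewrite /l1norm /l1norm_on big_mkcond /=; apply: ler_sum => i _.
by case: ifP => //; rewrite !inE negbK => /eqP ui; rewrite !mxE ui subr0.
Qed.

Lemma best_approx_l1_ge0 k (x : 'cV[R]_n) : 0 <= best_approx_l1 k x.
Proof.
by have [S _] := best_approx_l1_attained k x; apply: le_trans; rewrite sumr_ge0.
Qed.

Lemma best_approx_l1_sparse k (x : 'cV[R]_n) : (l0norm x <= k)%N -> best_approx_l1 k x = 0.
Proof.
move=> xk; apply/eqP; rewrite eq_le best_approx_l1_ge0 andbT; apply: ge_inf.
  by exists 0 => _ [u _ <-]; exact: l1norm_ge0.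
by exists x => //; rewrite subrr /l1norm big1 // => i _; rewrite mxE normr0.
Qed.

End BestApproximation.

(** * The stability bound under the weak RSP *)

Section StabilityBound.
Variables (R : realType) (m n : nat) (A : 'M[R]_(m, n)) (k : nat).
Hypotheses (rankA : \rank A = m) (rspA : weak_RSP A k).

Lemma weak_RSP_error_bound (y : 'cV[R]_m) (tau : R) (x : 'cV[R]_n) : 0 <= tau ->
  exists2 xs, DS_optimal A y tau xs &
    l2norm (x - xs) <= DS_gamma A y tau *
      (Num.max (linfnorm (A^T *m (A *m x - y)) - tau) 0 + 2 * best_approx_l1 k x
       + DS_c A * tau + DS_c A * linfnorm (A^T *m (A *m x - y))).
Proof.
move=> tau0.
(* A primal-dual pair with zero gap has zero residual in the optimality system, so the polyhedron is
   nonempty, as Robinson's bound requires. *)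
have Ax0 : A *m (A^T *m (invmx (A *m A^T) *m y)) = y.
  by rewrite mulmxA mulKVmx // gram_unitmx.
have [x1 [h1 [fx1 h1le gap1]]] := DS_dual_attained tau0 Ax0.
have [z1 _ res1] := DS_residual y tau x1 h1le.
have {res1} [sol1 sol2] : vec_le (DS_M1 A A 1 *m z1) (DS_rhs A y tau) /\
    DS_M2 A A y tau *m z1 = 0.
  have max0 : Num.max (linfnorm (A^T *m (A *m x1 - y)) - tau) 0 = 0.
    by apply/max_idPr; rewrite subr_le0.
  move: res1; rewrite max0 gap1 subrr normr0 addr0.
  move=> /eqP; rewrite paddr_eq0 ?pos_part_sum_ge0 ?l1norm_ge0 // => /andP[/eqP e1 /eqP e2].
  split.
    move=> i; have := (pos_part_sum_eq0 _).1 e1 i.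
    by move: (_ *m z1) (DS_rhs _ _ _) => u v; rewrite !mxE subr_le0.
  apply/colP => i; rewrite [RHS]mxE; apply/eqP; rewrite -normr_le0 -e2.
  exact: abs_le_l1norm.
have [S Sk Sx] := best_approx_l1_attained k x.
pose S1 := [set i in S | 0 < x i 0]; pose S2 := [set i in S | x i 0 < 0].
have disj : [disjoint S1 & S2].
  by rewrite -setI_eq0; apply/eqP/setP => i; rewrite !inE; case: (ltgtP (x i 0) 0); rewrite ?andbF.
have card12 : (#|S1| + #|S2| <= k)%N.
  rewrite -cardsUI (_ : S1 :&: S2 = finset.set0) ?cards0 ?addn0; last first.
    by apply/eqP; rewrite setI_eq0.
  apply: leq_trans Sk; apply: subset_leq_card; apply/fintype.subsetP => i.
  by rewrite !inE => /orP[] /andP[].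
have [zeta [[u zetaE] z1S z2S zout]] := rspA disj card12.
have zle i : `|zeta i 0| <= 1.
  have [/z1S ->|i1] := boolP (i \in S1); first by rewrite normr1.
  have [/z2S ->|i2] := boolP (i \in S2); first by rewrite normrN1.
  by apply: zout; rewrite inE negb_or i1.
have zle' : linfnorm (A^T *m u) <= 1 by rewrite -zetaE; apply/linfnorm_leP.
have [h hE hle] := DS_c_preimage rankA zle'.
have gle : linfnorm (A^T *m A *m h) <= 1 by rewrite hE.
have [z zx res] := DS_residual y tau x gle.
have [z' [s1 s2 zz']] := robinson_error_bound z sol1 sol2.
exists (usubmx z'); first exact: DS_system_optimal.
rewrite -zx; apply: le_trans (_ : _ <= l2norm (z - z')) _.
  rewrite -[X in _ <= l2norm X]vsubmxK; apply: le_trans (l2norm_col_mx _ (dsubmx (z - z'))).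
  by rewrite linearB.
apply: le_trans zz' _; rewrite -/(pos_part_sum _) subr0 res.
rewrite zx ler_wpM2l ?robinson_sigma_ge0 //.
set r := linfnorm (A^T *m (A *m x - y)).
have c0 := DS_c_ge0 A.
(* The three terms are controlled by [2 * best_approx_l1 k x], [DS_c A * tau] and [DS_c A * r]; the
   first one vanishes entrywise on [S], where [zeta] carries the signs of [x]. *)
have gapE : l1norm x + tau * l1norm h - dot y (A *m h) =
   (l1norm x - dot zeta x) + tau * l1norm h + dot (A^T *m (A *m x - y)) h.
  have -> : dot zeta x = dot (A^T *m A *m h) x by rewrite hE zetaE.
  by rewrite -mulmxA !(dot_mull A^T) trmxK dotDl dotNl (dotC (A *m x)); ring.
have [l1zeta0 l1zeta] : 0 <= l1norm x - dot zeta x /\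
    l1norm x - dot zeta x <= 2 * best_approx_l1 k x.
  rewrite dotE /l1norm -sumrB; split.
    apply: sumr_ge0 => i _; rewrite subr_ge0 (le_trans (ler_norm _)) // normrM.
    by rewrite ler_piMl.
  apply: (@le_trans _ _ (2 * l1norm_on (~: S) x)); last by rewrite ler_pM2l.
  rewrite /l1norm_on mulr_sumr [leRHS]big_mkcond /=; apply: ler_sum => i _.
  rewrite inE; have [iS|iS] := boolP (i \in S) => /=.
    have [xi|xi|->] := ltgtP (x i 0) 0.
    - by rewrite ltr0_norm // z2S ?inE ?iS //; lra.
    - by rewrite gtr0_norm // z1S ?inE ?iS //; lra.
    - by rewrite normr0 mulr0 subrr.
  by rewrite mulr_natl mulr2n lerD2l (le_trans (ler_norm _)) // normrN normrM ler_piMl.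
have := dot_le_linf_l1 (A^T *m (A *m x - y)) h; rewrite -/r.
have r0 : 0 <= r by exact: linfnorm_ge0.
have : tau * l1norm h <= tau * DS_c A by exact: ler_wpM2l.
have : r * l1norm h <= r * DS_c A by exact: ler_wpM2l.
have : 0 <= tau * l1norm h by rewrite mulr_ge0 // l1norm_ge0.
rewrite gapE => p1 p2 p3; rewrite ler_norml => /andP[p4 p5].
set v := l1norm x - _ in l1zeta0 l1zeta *.
have : `|v + tau * l1norm h + dot (A^T *m (A *m x - y)) h|
    <= 2 * best_approx_l1 k x + DS_c A * tau + DS_c A * r.
  by rewrite ler_norml; lra.
lra.
Qed.

End StabilityBound.

(** * Sufficient conditions for the weak RSP *)

Section Sufficient.
Variables (R : realType) (m n : nat) (A : 'M[R]_(m, n)) (k : nat).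

Lemma weak_RSP_stable (y : 'cV[R]_m) (tau : R) :
  \rank A = m -> weak_RSP A k -> 0 <= tau -> DS_stable A k y tau.
Proof.
move=> rankA rspA tau0 x fx.
have [xs opt bound] := weak_RSP_error_bound rankA rspA y x tau0.
exists xs => //; rewrite /DS_stable_at; rewrite /DS_feasible in fx.
rewrite (max_idPr _) ?subr_le0 // add0r in bound; rewrite bound /=.
have rle : DS_c A * linfnorm (A^T *m (A *m x - y)) <= DS_c A * tau.
  by rewrite ler_wpM2l ?DS_c_ge0.
have gamma0 : 0 <= DS_gamma A y tau by exact: robinson_sigma_ge0.
have := ler_wpM2l gamma0 rle; lra.
Qed.

(** The vector with entries 1 on [S1], -1 on [S2] and 0 elsewhere is k-sparse, and a dual
    certificate of its l1-minimality is the required [zeta]. *)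
Lemma sparse_recovery_weak_RSP :
  (forall x z : 'cV[R]_n, (l0norm x <= k)%N -> A *m z = A *m x -> l1norm x <= l1norm z) ->
  weak_RSP A k.
Proof.
move=> rec S1 S2 disj card12.
pose x : 'cV[R]_n := \col_i ((i \in S1)%:R - (i \in S2)%:R).
have x1 i : i \in S1 -> x i 0 = 1.
  by move=> i1; rewrite mxE i1 (disjointFr disj i1) subr0.
have x2 i : i \in S2 -> x i 0 = -1.
  by move=> i2; rewrite mxE i2 (disjointFl disj i2) sub0r.
have x0 i : i \notin S1 :|: S2 -> x i 0 = 0.
  by rewrite inE negb_or mxE => /andP[/negPf-> /negPf->]; rewrite subrr.
have xk : (l0norm x <= k)%N.
  apply: leq_trans card12; apply: leq_trans (leq_card_setU S1 S2).
  apply: subset_leq_card; apply/fintype.subsetP => i; rewrite inE.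
  by apply: contraNT => /x0 ->.
have [u Hu] := l1_min_certificate (fun z => rec x z xk).
exists (A^T *m u); split=> [|i i1|i i2|i _]; first by exists u.
- by have [_ + _] := Hu i; rewrite x1 //; apply.
- by have [_ _ +] := Hu i; rewrite x2 // ltrN10; apply.
- by have [] := Hu i.
Qed.

Lemma l1norm_split (S : {set 'I_n}) (x : 'cV[R]_n) :
  l1norm x = l1norm_on S x + l1norm_on (~: S) x.
Proof.
rewrite /l1norm (bigID (mem S)) /=; congr (_ + _).
by apply: eq_bigl => i; rewrite inE.
Qed.

(** The non-strict null space inequality gives minimality of sparse vectors without uniqueness,
    which is enough for the weak RSP. *)
Lemma weak_NSP_weak_RSP :
  (forall z : 'cV[R]_n, A *m z = 0 -> forall S : {set 'I_n}, (#|S| <= k)%N ->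
     l1norm_on S z <= l1norm_on (~: S) z) ->
  weak_RSP A k.
Proof.
move=> nsp; apply: sparse_recovery_weak_RSP => x z xk Azx.
pose S := [set i | x i 0 != 0].
have kerzx : A *m (z - x) = 0 by rewrite mulmxBr Azx subrr.
have := nsp _ kerzx S xk.
rewrite (l1norm_split S x) (l1norm_split S z).
have -> : l1norm_on (~: S) x = 0.
  by apply: big1 => i; rewrite !inE negbK => /eqP ->; rewrite normr0.
have -> : l1norm_on (~: S) (z - x) = l1norm_on (~: S) z.
  by apply: eq_bigr => i; rewrite !inE negbK => /eqP xi; rewrite !mxE xi subr0.
have : l1norm_on S x <= l1norm_on S z + l1norm_on S (z - x).
  rewrite /l1norm_on -big_split /=; apply: ler_sum => i _.
  by rewrite !mxE -lerBlDl distrC (le_trans _ (lerB_dist _ _)).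
lra.
Qed.

Lemma NSP_weak_RSP : NSP A k -> weak_RSP A k.
Proof.
move=> nsp; apply: weak_NSP_weak_RSP => z Az S Sk.
have [->|z0] := eqVneq z 0; last exact: ltW (nsp z z0 Az S Sk).
by rewrite /l1norm_on !big1 // => i _; rewrite mxE normr0.
Qed.

Lemma stable_NSP_NSP rho : stable_NSP A k rho -> NSP A k.
Proof.
move=> [/andP[rho0 rho1] nsp] z z0 Az S Sk.
have := nsp z z0 Az S Sk.
have c0 : 0 <= l1norm_on (~: S) z by rewrite sumr_ge0.
have s0 : 0 <= l1norm_on S z by rewrite sumr_ge0.
have : 0 < l1norm z.
  rewrite lt_neqAle l1norm_ge0 andbT eq_sym; apply: contra_neq z0 => /psumr_eq0P H.
  by apply/colP => i; rewrite mxE; apply/normr0_eq0/H.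
rewrite (l1norm_split S z); nra.
Qed.

Lemma robust_NSP_stable_NSP (N : 'cV[R]_m -> R) rho1 rho2 :
  robust_NSP A k N rho1 rho2 -> stable_NSP A k rho1.
Proof.
move=> [[_ NZ _] rho1b _ nsp]; split=> // z _ Az S Sk.
have := nsp z S Sk; rewrite Az.
have -> : N 0 = 0 by rewrite -[X in N X](scale0r 0) NZ normr0 mul0r.
by rewrite mulr0 addr0.
Qed.

Lemma RSP_weak_RSP : RSP A k -> weak_RSP A k.
Proof.
move=> rsp S1 S2 disj card12; have [z [zu z1 z2 z3]] := rsp S1 S2 disj card12.
by exists z; split=> // i /z3/ltW.
Qed.

End Sufficient.

(** * Mutual coherence *)

Section Coherence.
Variables (R : realType) (m n : nat) (A : 'M[R]_(m, n)).

Let gram i j : R := ((col i A)^T *m col j A) 0 0.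

Let gramC i j : gram i j = gram j i.
Proof. by rewrite /gram -!/(dot _ _) dotC. Qed.

Lemma le_mutual_coherence k (S : {set 'I_n}) i : #|S| = k -> i \notin S ->
  \sum_(j in S) `|((col i A)^T *m col j A) 0 0| <= mutual_coherence A k.
Proof.
move=> Sk iS; apply: le_trans (le_bigmax _ _ i).
by apply: (le_bigmax_cond _ (fun S : {set 'I_n} => \sum_(j in S) _)); rewrite Sk eqxx.
Qed.

(** As the Gram matrix has unit diagonal, [A^T A z = 0] bounds each [|z i|] by the off-diagonal
    terms of its row. Summed over [S] of size [k], an entry in [S] is weighted by at most mu_1(k-1)
    and one outside by at most mu_1(k). *)
Lemma coherence_weak_NSP k : normalized_columns A -> (0 < k <= n.-1)%N ->
  mutual_coherence A k + mutual_coherence A k.-1 < 1 ->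
  forall z : 'cV[R]_n, A *m z = 0 -> forall S : {set 'I_n}, (#|S| <= k)%N ->
  l1norm_on S z <= l1norm_on (~: S) z.
Proof.
move=> norm1 /andP[k0 kn] mu_lt1 z Az.
have full (S : {set 'I_n}) : #|S| = k -> l1norm_on S z <= l1norm_on (~: S) z.
  move=> Sk.
  have entry i : `|z i 0| <= \sum_(j | j != i) `|gram i j| * `|z j 0|.
    have : \sum_j gram i j * z j 0 = 0.
      transitivity ((A^T *m (A *m z)) i 0); last by rewrite Az mulmx0 mxE.
      rewrite mulmxA mxE; apply: eq_bigr => j _; congr (_ * _).
      by rewrite /gram !mxE; apply: eq_bigr => s _; rewrite !mxE.
    have gram1 : gram i i = 1 by rewrite /gram -/(dot _ _) -sqr_l2norm norm1 expr1n.
    rewrite (bigD1 i) //= gram1 mul1r => /eqP; rewrite addr_eq0 => /eqP ->.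
    rewrite normrN (le_trans (ler_norm_sum _ _ _)) // ler_sum // => j _.
    by rewrite normrM.
  have swap : l1norm_on S z <= \sum_j `|z j 0| * \sum_(i in S | j != i) `|gram j i|.
    apply: le_trans (ler_sum _ (fun i _ => entry i)) _.
    rewrite (exchange_big_dep xpredT) //= ler_sum // => j _.
    by rewrite mulr_sumr ler_sum // => i _; rewrite gramC mulrC.
  have split_le : \sum_j `|z j 0| * \sum_(i in S | j != i) `|gram j i| <=
      mutual_coherence A k.-1 * l1norm_on S z + mutual_coherence A k * l1norm_on (~: S) z.
    rewrite (bigID (mem S)) /= lerD //.
      rewrite mulr_sumr ler_sum // => j jS; rewrite mulrC ler_wpM2r //.
      rewrite (eq_bigl (mem (S :\ j))) => [|i]; last by rewrite !inE andbC eq_sym.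
      apply: le_mutual_coherence; last by rewrite !inE eqxx.
      by rewrite (cardsD1 j) jS in Sk; rewrite -Sk.
    rewrite mulr_sumr (eq_bigl (mem (~: S))) => [|j]; last by rewrite !inE.
    apply: ler_sum => j; rewrite !inE => jS; rewrite mulrC ler_wpM2r //.
    rewrite (eq_bigl (mem S)) => [|i]; last first.
      by rewrite andb_idr // => iS; apply/eqP => ji; rewrite ji iS in jS.
    exact: le_mutual_coherence.
  have c0 : 0 <= l1norm_on (~: S) z by rewrite sumr_ge0.
  have s0 : 0 <= l1norm_on S z by rewrite sumr_ge0.
  have mu0 : 0 <= mutual_coherence A k by exact: bigmax_ge_id.
  have mu0' : 0 <= mutual_coherence A k.-1 by exact: bigmax_ge_id.
  nra.
(* Coherence is a maximum over sets of size exactly [k], so a smaller [S] is enlarged; [k <= n.-1]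
   leaves room for this. *)
move=> S Sk; have [T ST Tk] : exists2 T : {set 'I_n}, S \subset T & #|T| = k.
  have PS : (S \subset S) && (#|S| <= k)%N by rewrite fintype.subxx.
  have [T /andP[ST Tk] Tmax] :=
    @arg_maxnP _ S (fun T : {set 'I_n} => (S \subset T) && (#|T| <= k)%N) (fun T => #|T|) PS.
  exists T => //; apply/eqP; rewrite eqn_leq Tk leqNgt; apply/negP => ltTk.
  have [i iT] : exists i, i \notin T.
    apply/existsP; rewrite -negb_forall; apply: contraTN ltTk => /forallP allT.
    rewrite -leqNgt (_ : T = [set: 'I_n]%SET).
      by rewrite cardsT card_ord (leq_trans kn) // leq_pred.
    by apply/setP => i; rewrite inE allT.
  have := Tmax (i |: T); rewrite cardsU1 iT add1n ltTk.
  rewrite (fintype.subset_trans ST (finset.subsetUr _ _)).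
  by move=> /(_ isT); rewrite /= ltnn.
have ler_l1 (U V : {set 'I_n}) : U \subset V -> l1norm_on U z <= l1norm_on V z.
  move=> /fintype.subsetP UV; rewrite /l1norm_on big_mkcond [leRHS]big_mkcond /=.
  by apply: ler_sum => i _; case: ifP => [/UV ->|] //; case: ifP.
apply: le_trans (ler_l1 _ _ ST) (le_trans (full T Tk) (ler_l1 _ _ _)).
by rewrite finset.setCS.
Qed.

End Coherence.

(** * The restricted isometry property *)

Section RestrictedIsometry.
Variable R : realType.

(** [theta] separates the [k] largest entries from the rest and serves as the multiplier of the
    constraint sum p <= k; the last clause is its complementary slackness. *)
Lemma top_entries n k (w : 'I_n -> R) : (forall i, 0 <= w i) ->
  exists (T : {set 'I_n}) (theta : R), [/\ (#|T| <= k)%N, 0 <= theta,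
    forall i, i \in T -> theta <= w i, forall i, i \notin T -> w i <= theta &
    (#|T| < k)%N -> theta = 0].
Proof.
move=> w0; elim: k => [|k [T [theta [Tk theta0 wT wC small]]]].
  (* For [k = 0] the threshold only has to dominate every entry. *)
  exists finset.set0, (\sum_i w i); split=> // [||i|i _].
  - by rewrite cards0.
  - exact: sumr_ge0.
  - by rewrite inE.
  - by rewrite (bigD1 i) //= lerDl sumr_ge0.
have [full|[i0 i0T]] : (forall i, i \in T) \/ exists i, i \notin T.
    by have [/forallP|/forallPn] := boolP [forall i, i \in T]; [left|right].
  exists T, 0; split=> // [|i]; first exact: leqW.
  by rewrite full.
have [i1 i1T i1max] := @arg_maxP _ _ _ i0 [pred i | i \notin T] w i0T.
rewrite /= in i1T.
exists (i1 |: T), (w i1); split=> [|//|i|i|].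
- by rewrite cardsU1 i1T.
- rewrite !inE => /orP[/eqP -> //|iT].
  exact: le_trans (wC _ i1T) (wT _ iT).
- by rewrite !inE negb_or => /andP[_ iT]; exact: i1max.
- rewrite cardsU1 i1T add1n ltnS => /small theta_eq0; apply/eqP.
  by rewrite eq_le w0 andbT -theta_eq0 wC.
Qed.

(* The maximum of a linear form over the polytope 0 <= p <= 1, sum p <= k; this takes
   the place of the sparse representation of a polytope in the proof of Cai and Zhang. *)
Lemma top_entries_max n k (w p : 'I_n -> R) (T : {set 'I_n}) theta :
  (#|T| <= k)%N -> 0 <= theta ->
  (forall i, i \in T -> theta <= w i) -> (forall i, i \notin T -> w i <= theta) ->
  ((#|T| < k)%N -> theta = 0) ->
  (forall i, 0 <= p i <= 1) -> \sum_i p i <= k%:R ->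
  \sum_i w i * p i <= \sum_(i in T) w i.
Proof.
move=> Tk theta0 wT wC small p01 pk.
rewrite -subr_le0 [X in _ - X]big_mkcond -sumrB /=.
apply: (@le_trans _ _ (theta * (\sum_i p i - #|T|%:R))).
  rewrite mulrBr mulr_sumr -sumr_const mulr_sumr [X in _ <= _ - X]big_mkcond -sumrB /=.
  apply: ler_sum => i _; have /andP[p0 p1] := p01 i.
  have [iT|iT] := boolP (i \in T).
    by have := wT i iT; nra.
  by have := wC i iT; nra.
move: Tk; rewrite leq_eqVlt => /orP[/eqP ->|/small ->]; last by rewrite mul0r.
by rewrite mulr_ge0_le0 // subr_le0.
Qed.

End RestrictedIsometry.

Section RIP.
Variables (R : realType) (m n : nat) (A : 'M[R]_(m, n)) (k : nat) (delta : R).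

(* With a = 1/2 - mu and b = mu/2, the quadratic terms in u of
   |A (a h0 - b u)|^2 and |A (h0 + mu u)|^2 / 4 agree, so their difference is
   affine in u. *)
Lemma RIP_affine_gap (mu : R) (h0 u : 'cV[R]_n) :
  dot (A *m ((2^-1 - mu) *: h0 - (mu / 2) *: u)) (A *m ((2^-1 - mu) *: h0 - (mu / 2) *: u))
    - dot (A *m (h0 + mu *: u)) (A *m (h0 + mu *: u)) / 4 =
  - (mu * (1 - mu)) * (dot (A *m h0) (A *m h0) + dot (A *m h0) (A *m u)).
Proof.
rewrite -scaleNr !mulmxDr -!scalemxAr; move: (A *m h0) (A *m u) => p q.
rewrite !dotDl !dotDr !dotZl !dotZr (dotC q p).
by field.
Qed.

(** RIP from below at [h0 + mu u] and from above at the other combination in [RIP_affine_gap] bounds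
    the gap by [K |h0|^2], whereas the last hypothesis makes the gap nonnegative; [K < 0] then
    forces [h0 = 0]. *)
Lemma RIP_sparse_dual (h0 u : 'cV[R]_n) :
  RIP A (2 * k) delta -> delta < 1 / Num.sqrt 2 ->
  (l0norm h0 <= k)%N -> (l0norm u <= k)%N -> (forall i, h0 i 0 * u i 0 = 0) ->
  dot u u <= dot h0 h0 -> dot (A *m h0) (A *m h0) + dot (A *m h0) (A *m u) <= 0 ->
  h0 = 0.
Proof.
move=> [/andP[d0 d1] rip] d2 h0k uk h0u uh le0.
have delta2 : 2 * delta ^+ 2 < 1.
  have s0 : 0 < Num.sqrt 2 :> R by rewrite sqrtr_gt0.
  have s2 : Num.sqrt 2 ^+ 2 = 2 :> R by rewrite sqr_sqrtr.
  move: d2; rewrite ltr_pdivlMr // => d2.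
  have : (delta * Num.sqrt 2) ^+ 2 < 1.
    by rewrite expr_lt1 // mulr_ge0 ?ltW.
  by rewrite exprMn s2 mulrC.
have sparse a b : (l0norm (a *: h0 + b *: u) <= 2 * k)%N.
  rewrite mul2n -addnn; apply: leq_trans (leq_add h0k uk).
  apply: leq_trans (leq_card_setU _ _); apply: subset_leq_card.
  apply/fintype.subsetP => i; rewrite !inE !mxE; apply: contraNT.
  by rewrite negb_or !negbK => /andP[/eqP -> /eqP ->]; rewrite !mulr0 addr0.
have orth : dot h0 u = 0 by rewrite dotE big1.
have sq a b : dot (a *: h0 + b *: u) (a *: h0 + b *: u) =
    a ^+ 2 * dot h0 h0 + b ^+ 2 * dot u u.
  by rewrite !dotDl !dotDr !dotZl !dotZr (dotC u h0) orth; ring.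
(* The minimiser of delta/2 - (1 + delta) mu + (1 + 3 delta/2) mu^2, whose minimum is
   negative exactly when 2 delta^2 < 1. *)
pose mu := (1 + delta) / (2 + 3 * delta).
have den : 0 < 2 + 3 * delta by lra.
have mu0 : 0 < mu by rewrite divr_gt0 //; lra.
have mu1 : mu < 1 by rewrite ltr_pdivrMr //; lra.
have muE : mu * (2 + 3 * delta) = 1 + delta by rewrite /mu divfK // gt_eqF.
have gap := RIP_affine_gap mu h0 u.
have /andP[low _] := rip _ (sparse 1 mu).
have /andP[_ up] := rip _ (sparse (2^-1 - mu) (- (mu / 2))).
rewrite !sqr_l2norm !sq scale1r in low; rewrite !sqr_l2norm !sq scaleNr in up.
apply: dot_eq0; set X := dot h0 h0 in low up uh *; set U := dot u u in low up uh.
have X0 : 0 <= X by exact: dot_ge0.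
have gap0 : 0 <= - (mu * (1 - mu)) * (dot (A *m h0) (A *m h0) + dot (A *m h0) (A *m u)).
  by rewrite mulNr -mulrN mulr_ge0 ?oppr_ge0 // mulr_ge0 ?subr_ge0 ?ltW.
rewrite -gap in gap0.
pose K := delta / 2 - (1 + delta) * mu + (1 + 3 / 2 * delta) * mu ^+ 2.
have K0 : K < 0.
  have -> : K = (2 * delta ^+ 2 - 1) / (2 * (2 + 3 * delta)).
    by rewrite /K /mu; field; rewrite gt_eqF.
  by rewrite pmulr_llt0 ?subr_lt0 // invr_gt0 mulr_gt0.
have UX : delta / 2 * mu ^+ 2 * U <= delta / 2 * mu ^+ 2 * X.
  by rewrite ler_wpM2l // mulr_ge0 ?sqr_ge0 // divr_ge0 // ltW.
have KX : 0 <= K * X by rewrite /K; lra.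
by apply/eqP; rewrite eq_le X0 andbT -(nmulr_rge0 _ K0).
Qed.

(* If z = h failed the inequality, the linear form dot (A h0) (A u), where h0 is the
   restriction of h to its k largest entries T0, would attain on the k-sparse vectors u
   supported off T0 and bounded by alpha a value at most its value at h - h0,
   which is minus dot (A h0) (A h0). *)
Lemma RIP_weak_NSP : RIP A (2 * k) delta -> delta < 1 / Num.sqrt 2 ->
  forall z : 'cV[R]_n, A *m z = 0 -> forall S : {set 'I_n}, (#|S| <= k)%N ->
  l1norm_on S z <= l1norm_on (~: S) z.
Proof.
move=> rip d2 h Ah S Sk; rewrite leNgt; apply/negP => ltS.
have [T0 [th0 [T0k th0_ge0 T0in T0out T0small]]] :=
  top_entries k (fun i => normr_ge0 (h i 0)).
have leT0 : l1norm_on S h <= l1norm_on T0 h.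
  have pk : \sum_i (i \in S)%:R <= k%:R :> R.
    rewrite -(ler_nat R) in Sk; apply: le_trans Sk; rewrite -sumr_const [leRHS]big_mkcond /=.
    by apply: ler_sum => i _; case: ifP.
  apply: le_trans (top_entries_max T0k th0_ge0 T0in T0out T0small _ pk).
    by rewrite /l1norm_on big_mkcond /=; apply: ler_sum => i _; case: ifP; rewrite ?mulr1 ?mulr0.
  by move=> i; rewrite ler0n lern1 leq_b1.
set s := l1norm_on T0 h in leT0.
have lts : l1norm_on (~: T0) h < s.
  by have := l1norm_split T0 h; rewrite (l1norm_split S h) -/s; lra.
have c0 : 0 <= l1norm_on (~: T0) h by rewrite sumr_ge0.
have k0 : (0 < k)%N.
  rewrite lt0n; apply: contraTneq ltS => k0; move: Sk; rewrite k0 leqn0 cards_eq0 => /eqP ->.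
  by rewrite /l1norm_on big_set0 -leNgt sumr_ge0.
have k0' : 0 < k%:R :> R by rewrite ltr0n.
(* Off [T0] the entries of [h] are at most [th0 <= alpha] in absolute value and sum to less than
   [s = k alpha], so after division by [alpha] they lie in the polytope of [top_entries_max]. *)
pose alpha := s / k%:R.
have alpha0 : 0 < alpha by rewrite divr_gt0 //; lra.
have th0_le : th0 <= alpha.
  rewrite ler_pdivlMr //; move: T0k; rewrite leq_eqVlt => /orP[/eqP <-|/T0small ->].
    by rewrite mulr_natr -sumr_const ler_sum.
  by rewrite mul0r; lra.
pose h0 : 'cV[R]_n := \col_i (if i \in T0 then h i 0 else 0).
pose c := A^T *m (A *m h0).
pose w i := if i \in T0 then 0 else `|c i 0|.
have w0 i : 0 <= w i by rewrite /w; case: ifP.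
have [T1 [th1 [T1k th1_ge0 T1in T1out T1small]]] := top_entries k w0.
(* The signs are chosen to minimise the linear form with coefficients [c] among vectors supported on
   [T1] outside [T0] with entries bounded by [alpha]. *)
pose u : 'cV[R]_n := \col_i (if (i \in T1) && (i \notin T0) then - alpha * Num.sg (c i 0) else 0).
have h00 : h0 = 0.
  apply: (@RIP_sparse_dual h0 u) => //.
  - apply: leq_trans T0k; apply: subset_leq_card; apply/fintype.subsetP => i.
    by rewrite inE mxE; case: ifP => //; rewrite eqxx.
  - apply: leq_trans T1k; apply: subset_leq_card; apply/fintype.subsetP => i.
    by rewrite inE mxE; case: ifP => [/andP[]//|]; rewrite eqxx.
  - by move=> i; rewrite !mxE; case: ifP => iT0; rewrite ?andbF ?mulr0 ?mul0r.
  (* Both sides are compared with [k alpha^2]; that [|h0|^2] is at least this much is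
     Cauchy-Schwarz, expanded as a sum of squares. *)
  - have ule : dot u u <= k%:R * alpha ^+ 2.
      apply: (@le_trans _ _ (\sum_(i in T1) alpha ^+ 2)); last first.
        by rewrite sumr_const -[alpha ^+ 2 *+ _]mulr_natl ler_wpM2r ?sqr_ge0 // ler_nat.
      rewrite dotE [leRHS]big_mkcond /=; apply: ler_sum => i _; rewrite !mxE.
      case: (i \in T1); case: (i \in T0); rewrite /= ?mulr0 ?sqr_ge0 //.
      rewrite -expr2 exprMn sqrrN sqr_sg ler_piMr ?sqr_ge0 //.
      by case: (_ == _) => /=; rewrite ?ler01.
    apply: le_trans ule _.
    have -> : dot h0 h0 = \sum_(i in T0) `|h i 0| ^+ 2.
      rewrite dotE [RHS]big_mkcond /=; apply: eq_bigr => i _; rewrite !mxE.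
      by case: ifP => _; rewrite ?mulr0 // real_normK ?num_real.
    have : 0 <= \sum_(i in T0) (`|h i 0| - alpha) ^+ 2.
      by apply: sumr_ge0 => i _; exact: sqr_ge0.
    have -> : \sum_(i in T0) (`|h i 0| - alpha) ^+ 2 =
        \sum_(i in T0) `|h i 0| ^+ 2 - 2 * alpha * s + #|T0|%:R * alpha ^+ 2.
      rewrite [#|T0|%:R * _]mulr_natl -sumr_const /s /l1norm_on mulr_sumr -sumrB -big_split /=.
      by apply: eq_bigr => i _; ring.
    have : #|T0|%:R * alpha ^+ 2 <= k%:R * alpha ^+ 2.
      by rewrite ler_wpM2r ?sqr_ge0 // ler_nat.
    have -> : s = alpha * k%:R by rewrite /alpha divfK // gt_eqF.
    lra.
  - have -> : dot (A *m h0) (A *m h0) + dot (A *m h0) (A *m u) = dot c (h0 + u - h).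
      have c_h : dot c h = 0 by rewrite /c -dot_mulr Ah dot0r.
      by rewrite -dotDr -mulmxDr dot_mulr -/c [RHS]dotDr dotNr c_h subr0.
    pose p i := if i \in T0 then 0 else `|h i 0| / alpha.
    have p01 i : 0 <= p i <= 1.
      rewrite /p; case: ifPn => iT0; first by rewrite lexx ler01.
      rewrite divr_ge0 ?(ltW alpha0) //= ler_pdivrMr // mul1r.
      exact: le_trans (T0out i iT0) th0_le.
    have pk : \sum_i p i <= k%:R.
      have -> : \sum_i p i = l1norm_on (~: T0) h / alpha.
        rewrite /l1norm_on [in RHS]big_mkcond mulr_suml; apply: eq_bigr => i _.
        by rewrite inE /p; case: ifP; rewrite ?mul0r.
      by rewrite ler_pdivrMr // mulrC divfK ?(ltW lts) // gt_eqF.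
    have := top_entries_max T1k th1_ge0 T1in T1out T1small p01 pk.
    rewrite -subr_le0 -(pmulr_rle0 _ alpha0); apply: le_trans.
    rewrite [X in _ * (_ - X)]big_mkcond -sumrB mulr_sumr dotE /=; apply: ler_sum => i _.
    have -> : (h0 + u - h) i 0 = if i \in T0 then 0 else
        (if i \in T1 then - alpha * Num.sg (c i 0) else 0) - h i 0.
      by rewrite !mxE; case: (i \in T0); case: (i \in T1) => /=;
        rewrite ?addr0 ?add0r ?subrr.
    rewrite /w /p; case: (i \in T0); first by case: ifP; rewrite !mulr0 subrr mulr0.
    move: (c i 0) (h i 0) => ci hi.
    have cancel : alpha * (`|ci| * (`|hi| / alpha)) = `|ci| * `|hi|.
      by rewrite mulrCA [alpha * _]mulrC divfK // gt_eqF.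
    have ch : - (ci * hi) <= `|ci| * `|hi| by rewrite -normrM -normrN ler_norm.
    have sgn : alpha * (ci * Num.sg ci) = alpha * `|ci| by rewrite [ci * _]mulrC -normrEsg.
    rewrite [alpha * _]mulrBr cancel; case: ifP => _; last by rewrite sub0r mulrN mulr0 subr0.
    by lra.
move: lts; rewrite (_ : s = 0) ?ltNge ?c0 //.
by apply: big1 => i iT; move/colP/(_ i): h00; rewrite !mxE iT => ->; rewrite normr0.
Qed.

End RIP.

Theorem corollary3p4 (R : realType) (m n : nat) (A : 'M[R]_(m, n)) (k : nat)
    (rankA : \rank A = m) (ltmn : (m < n)%N) :
  (* (i), direct part *)
  (weak_RSP A k ->
     forall (y : 'cV[R]_m) (tau : R), 0 <= tau ->
       (forall x : 'cV[R]_n, exists2 xs : 'cV[R]_n, DS_optimal A y tau xs &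
          l2norm (x - xs) <=
            DS_gamma A y tau *
              (Num.max (linfnorm (A^T *m (A *m x - y)) - tau) 0
               + 2 * best_approx_l1 k x
               + DS_c A * tau
               + DS_c A * linfnorm (A^T *m (A *m x - y))))
       /\ DS_stable A k y tau)
  (* (i), converse *)
  /\ ((forall y : 'cV[R]_m, exists2 tau0 : R, 0 < tau0 &
         forall tau : R, 0 <= tau <= tau0 -> DS_stable A k y tau) ->
      weak_RSP A k)
  (* (ii) *)
  /\ (forall (y : 'cV[R]_m) (tau : R), 0 <= tau ->
        (normalized_columns A -> (1 <= k <= n.-1)%N ->
           mutual_coherence A k + mutual_coherence A k.-1 < 1 ->
           DS_stable A k y tau)
        /\ (forall delta : R, delta < 1 / Num.sqrt 2 ->
              RIP A (2 * k) delta -> DS_stable A k y tau)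
        /\ (forall rho : R, stable_NSP A k rho -> DS_stable A k y tau)
        /\ (forall (N : 'cV[R]_m -> R) (rho1 rho2 : R),
              robust_NSP A k N rho1 rho2 -> DS_stable A k y tau)
        /\ (NSP A k -> DS_stable A k y tau)
        /\ (RSP A k -> DS_stable A k y tau)).
Proof.
have stab := weak_RSP_stable rankA.
split; [|split].
- move=> rspA y tau tau0; split; last exact: stab.
  by move=> x; exact: weak_RSP_error_bound.
- move=> H; apply: sparse_recovery_weak_RSP => x z xk Azx.
  (* With data [y = A x] the residual of [x] is 0, so for [tau = 0] the whole bound vanishes on a
     k-sparse [x], which is therefore optimal itself. *)
  have [tau0 tau0_gt0 /(_ 0)] := H (A *m x); rewrite lexx ltW // => /(_ isT x)[].
    by apply/linfnorm_leP => // i; rewrite subrr mulmx0 mxE normr0.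
  move=> xs [_ xs_min] /andP[+ _].
  have r0 : linfnorm (A^T *m (A *m x - A *m x)) = 0.
    apply/eqP; rewrite eq_le linfnorm_ge0 andbT; apply/linfnorm_leP => // i.
    by rewrite subrr mulmx0 mxE normr0.
  rewrite r0 best_approx_l1_sparse // !mulr0 !addr0 mulr0 => le0.
  have -> : x = xs.
    apply/subr0_eq/dot_eq0; rewrite -sqr_l2norm.
    have -> : l2norm (x - xs) = 0 by apply/eqP; rewrite eq_le le0 l2norm_ge0.
    by rewrite expr0n.
  apply: xs_min; apply/linfnorm_leP => // i.
  by rewrite Azx subrr mulmx0 mxE normr0.
- move=> y tau tau0; do ! split.
  + by move=> norm1 kb mu1; apply: stab => //; exact/weak_NSP_weak_RSP/coherence_weak_NSP.
  + by move=> delta d2 rip; apply: stab => //; exact/weak_NSP_weak_RSP/(RIP_weak_NSP rip d2).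
  + by move=> rho /stable_NSP_NSP/NSP_weak_RSP rsp; exact: stab.
  + by move=> N rho1 rho2 /robust_NSP_stable_NSP/stable_NSP_NSP/NSP_weak_RSP rsp; exact: stab.
  + by move=> /NSP_weak_RSP rsp; exact: stab.
  + by move=> /RSP_weak_RSP rsp; exact: stab.
Qed.
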